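(* MEFE-Matching can be solved in polynomial time when the number of courses and the capacity of each course are constant. That is, for all fixed constants $N,C$ there is a polynomial-time algorithm that, given an instance with at most $N$ courses, each of capacity at most $C$, outputs a MEFE matching if one exists and correctly reports that none exists otherwise.
   Context: An instance of MEFE-Matching consists of: a finite set of courses $X=\{x_1,\dots,x_n\}$; a finite set of TAs $T=\{t_1,\dots,t_m\}$; for each TA $t_i$ a utility (valuation) function $u_i=u_{t_i}\colon X\to\mathbb{Z}_{\ge 0}$ and a grade function $g_i=g_{t_i}\colon X\to\mathbb{Q}_{\ge 0}$; for each course $x_i$ a capacity $c_i$ (a positive integer) and a utility (valuation) function $v_i=v_{x_i}\colon T\to\mathbb{Z}_{\ge 0}$, where for every TA $t$ and course $x_i$ one has $v_i(t)=0$ if $u_t(x_i)=0$ and $v_i(t)>0$ otherwise; and a number $k\in\mathbb{Q}_{\ge 0}$. All numbers are encoded in binary. A matching is a function $\mu\colon T\to X\cup\{\emptyset\}$, where $\mu(t)=\emptyset$ means $t$ is unassigned; by convention $u_t(\emptyset)=0$. It is feasible if $|\mu^{-1}(x_i)|=c_i$ for every course $x_i$ and no TA $t$ is assigned to a course $x$ with $u_t(x)=0$. A MEFE (merit-based envy-free egalitarian) matching is a feasible matching $\mu$ such that (1) (satisfaction of courses) for every course $x_i$, $\mathrm{AvgUtil}(x_i)=\frac{1}{c_i}\sum_{t\in\mu^{-1}(x_i)}v_i(t)\ge k$; and (2) (merit-based envy-freeness) there are no two TAs $t_i,t_j$ with $\mu(t_j)\in X$, $g_i(\mu(t_j))\ge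 g_j(\mu(t_j))$ and $u_i(\mu(t_j))>u_i(\mu(t_i))$. *)

(* Defs.v *)
From HB Require Import structures.
From mathcomp Require Import all_boot all_order all_algebra.

Set Implicit Arguments.
Unset Strict Implicit.
Unset Printing Implicit Defensive.

Import Order.TTheory GRing.Theory Num.Theory.
Local Open Scope ring_scope.

(** * Instances and matchings *)

(* Courses are 'I_n and TAs are 'I_m; elements of Z_{>=0} are [nat]s. *)
Record instance := Instance {
  ncourses : nat;
  ntas : nat;
  utility : 'I_ntas -> 'I_ncourses -> nat;
  grade : 'I_ntas -> 'I_ncourses -> rat;
  capacity : 'I_ncourses -> nat;
  valuation : 'I_ncourses -> 'I_ntas -> nat;
  threshold : rat;
  grade_ge0 : forall t x, 0 <= grade t x;
  capacity_gt0 : forall x, (0 < capacity x)%N;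
  valuation_eq0 : forall t x, (valuation x t = 0 <-> utility t x = 0)%N;
  threshold_ge0 : 0 <= threshold
}.

(* [None] is the outcome "unassigned". *)
Definition matching (I : instance) := {ffun 'I_(ntas I) -> option 'I_(ncourses I)}.

Section Matchings.
Variables (I : instance) (mu : matching I).

Definition assigned (x : 'I_(ncourses I)) : {set 'I_(ntas I)} :=
  [set t | mu t == Some x].

Definition outcome_utility (t : 'I_(ntas I)) (o : option 'I_(ncourses I)) : nat :=
  if o is Some x then utility t x else 0%N.

Definition feasible : Prop :=
  (forall x, #|assigned x| = capacity x) /\
  (forall t x, mu t = Some x -> utility t x <> 0%N).

Definition avg_util (x : 'I_(ncourses I)) : rat :=
  (capacity x)%:R^-1 * \sum_(t in assigned x) (valuation x t)%:R.

Definition courses_satisfied : Prop := forall x, threshold I <= avg_util x.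

Definition merit_envy_free : Prop :=
  ~ exists (ti tj : 'I_(ntas I)) (x : 'I_(ncourses I)),
      [/\ mu tj = Some x, grade tj x <= grade ti x
        & (outcome_utility ti (mu ti) < outcome_utility ti (Some x))%N].

Definition mefe : Prop := [/\ feasible, courses_satisfied & merit_envy_free].

End Matchings.

Definition correct_answer (I : instance) (ans : option (matching I)) : Prop :=
  if ans is Some mu then mefe mu else ~ exists mu : matching I, mefe mu.

(** * Encodings as bit strings *)

(* Little-endian binary expansion, without leading zeros (empty for 0). *)
Definition binary (n : nat) : seq bool :=
  mkseq (fun i => odd (n %/ 2 ^ i)%N) (up_log 2 n.+1).

(* Self-delimiting: 1 announces an item, 0 ends the list.  Hence all the codes
   below are prefix-free and can be concatenated without separators. *)
Definition encode_seq (A : Type) (enc : A -> seq bool) (s : seq A) : seq bool :=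
  flatten [seq true :: enc a | a <- s] ++ [:: false].

Definition encode_nat (n : nat) : seq bool :=
  encode_seq (fun b : bool => [:: b]) (binary n).

(* Only used for nonnegative rationals: the sign is dropped. *)
Definition encode_rat (q : rat) : seq bool :=
  encode_nat `|numq q|%N ++ encode_nat `|denq q|%N.

Definition encode_option (A : Type) (enc : A -> seq bool) (o : option A) : seq bool :=
  if o is Some a then true :: enc a else [:: false].

Definition encode_instance (I : instance) : seq bool :=
  encode_seq
    (fun x : 'I_(ncourses I) =>
       encode_nat (capacity x) ++ encode_seq encode_nat (codom (valuation x)))
    (enum 'I_(ncourses I)) ++
  encode_seq
    (fun t : 'I_(ntas I) =>
       encode_seq encode_nat (codom (utility t)) ++
       encode_seq encode_rat (codom (grade t)))
    (enum 'I_(ntas I)) ++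
  encode_rat (threshold I).

Definition encode_matching (I : instance) (mu : matching I) : seq bool :=
  encode_seq (encode_option (fun x : 'I_(ncourses I) => encode_nat x)) (codom mu).

Definition encode_answer (I : instance) (ans : option (matching I)) : seq bool :=
  encode_option (@encode_matching I) ans.

(** * Deterministic multitape Turing machines *)

(* [None] is the blank. *)
Notation symbol := (option bool).

Inductive move := MoveLeft | Stay | MoveRight.

(* A tape infinite in both directions: the cells to the left of the head, nearest
   first, and the cells from the head rightwards; cells not listed are blank. *)
Record tape := Tape { cells_left : seq symbol; cells_right : seq symbol }.

Definition tape_read (tp : tape) : symbol := head None (cells_right tp).

Definition tape_write (s : symbol) (tp : tape) : tape :=
  Tape (cells_left tp) (s :: behead (cells_right tp)).

Definition tape_move (d : move) (tp : tape) : tape :=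
  let: Tape l r := tp in
  match d with
  | MoveLeft => Tape (behead l) (head None l :: r)
  | Stay => tp
  | MoveRight => Tape (head None r :: l) (behead r)
  end.

(* There are [extra_tapes.+1] tapes; tape [ord0] carries the input and the output.
   The machine halts when [transition] returns [None]. *)
Record machine := Machine {
  extra_tapes : nat;
  state : finType;
  initial_state : state;
  transition : state -> {ffun 'I_extra_tapes.+1 -> symbol} ->
               option (state * {ffun 'I_extra_tapes.+1 -> symbol * move})
}.

Section Runs.
Variable M : machine.

Definition config : Type := state M * {ffun 'I_(extra_tapes M).+1 -> tape}.

Definition initial_config (w : seq bool) : config :=
  (initial_state M,
   [ffun i => Tape [::] (if i == ord0 then map Some w else [::])]).

Definition next_config (c : config) : option config :=
  let: (q, tps) := c in
  if transition q [ffun i => tape_read (tps i)] is Some (q', act) then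
    Some (q', [ffun i => tape_move (act i).2 (tape_write (act i).1 (tps i))])
  else None.

(* The halting configuration, if it is reached in at most [n] steps. *)
Fixpoint run (n : nat) (c : config) : option config :=
  if next_config c is Some c' then
    if n is n'.+1 then run n' c' else None
  else Some c.

Fixpoint word_until_blank (s : seq symbol) : seq bool :=
  if s is Some b :: s' then b :: word_until_blank s' else [::].

(* The output extends from the head to the first blank. *)
Definition output (c : config) : seq bool :=
  word_until_blank (cells_right (c.2 ord0)).

Definition outputs_within (n : nat) (w out : seq bool) : Prop :=
  exists2 c, run n (initial_config w) = Some c & output c = out.

End Runs.

(* Main.v *)
(* The capacities add up to at most N * C, so a MEFE matching assigns at most N * C TAs
   and is obtained from the empty matching by N * C single reassignments.  As N * C is
   fixed, listing all results of such reassignments and testing them one by one takes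
   polynomial time.  Turing machines enter through a small language of programs with
   three stacks of bits.  Since all codes are self-delimiting, a program replacing the
   code on top of a stack by the code of its image under f can ignore what lies below,
   so that the functions computed in this way in polynomial time are closed under
   composition, pairing, case analysis and folds with moderately growing accumulators. *)
Require Import Defs.
From mathcomp Require Import all_boot all_order all_algebra.
From mathcomp Require Import zify.

Set Implicit Arguments.
Unset Strict Implicit.
Unset Printing Implicit Defensive.

Import GRing.Theory Num.Theory.

(** The obstacle is to bound the running time of a concrete machine without reasoning about
    machines. A program finds the end of a code only by parsing it along its type, so every coded
    type carries a command that lifts its codes off the stack. Whatever lies below is universally
    quantified, which makes programs composable without any addressing of memory. Time bounds also
    bound sizes, so compositions need no size analysis. Folds do: iterating a polynomial-time step
    may double the accumulator in each round. Almost everywhere it suffices that a round adds an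
    amount depending only on the environment and the current element. Numbers have two codes.
    Utilities, grades, valuations and capacities are binary, as in the input; indices of TAs and
    courses are unary, because they drive loops, and this is harmless since there are no more of
    them than input bits. The number of reassignments is not data: its rounds are unfolded when the
    program is built, so it only affects the program and the degree of its time bound. *)

(** * A language of programs on three stacks, with running times *)

Inductive var := V0 | V1 | V2.

Definition stacks : Type := seq bool * seq bool * seq bool.

Definition get (v : var) (st : stacks) : seq bool :=
  match v with V0 => st.1.1 | V1 => st.1.2 | V2 => st.2 end.

Definition set (v : var) (s : seq bool) (st : stacks) : stacks :=
  let: (s0, s1, s2) := st in
  match v with V0 => (s, s1, s2) | V1 => (s0, s, s2) | V2 => (s0, s1, s) end.

Inductive cmd :=
| Push of var & bool
| Pop of var
| Seq of cmd & cmd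
| If of var & cmd & cmd
| While of var & cmd.

Notation "a ;; b" := (Seq a b) (at level 90, right associativity).

Definition top (v : var) (st : stacks) : bool := head false (get v st).

(* The last argument is an upper bound on the running time of the compiled machine. *)
Inductive exec : cmd -> stacks -> stacks -> nat -> Prop :=
| exec_push v b st : exec (Push v b) st (set v (b :: get v st) st) 2
| exec_pop v st : exec (Pop v) st (set v (behead (get v st)) st) 1
| exec_seq a b st1 st2 st3 t1 t2 :
    exec a st1 st2 t1 -> exec b st2 st3 t2 -> exec (a ;; b) st1 st3 (t1 + t2)
| exec_if v a b st1 st2 t :
    exec (if top v st1 then a else b) st1 st2 t -> exec (If v a b) st1 st2 t.+1
| exec_while_stop v a st : top v st = false -> exec (While v a) st st 1
| exec_while_step v a st1 st2 st3 t1 t2 :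
    top v st1 -> exec a st1 st2 t1 -> exec (While v a) st2 st3 t2 ->
    exec (While v a) st1 st3 (t1 + t2).+1
| exec_weaken a st1 st2 t t' : exec a st1 st2 t -> t <= t' -> exec a st1 st2 t'.

Definition height (st : stacks) : nat := size st.1.1 + size st.1.2 + size st.2.

(** A push adds one bit and is charged two steps, and nothing else adds bits. This is what turns
    time bounds into bounds on the codes of results. *)
Lemma exec_height a st1 st2 t : exec a st1 st2 t -> height st2 <= height st1 + t.
Proof.
rewrite /height; elim=> {a st1 st2 t}.
- by move=> [] b [[s0 s1] s2] /=; lia.
- by move=> [] [[s0 s1] s2] /=; rewrite size_behead; lia.
- by move=> *; lia.
- by move=> *; lia.
- by move=> *; lia.
- by move=> *; lia.
- by move=> *; lia.
Qed.

(** * Compilation to Turing machines *)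

Notation tapes := {ffun 'I_3 -> tape}.
Notation action := {ffun 'I_3 -> symbol * move}.
Notation reading := {ffun 'I_3 -> symbol}.

Definition tape_of (v : var) : 'I_3 :=
  match v with V0 => ord0 | V1 => Ordinal (isT : 1 < 3) | V2 => ord_max end.

(* Pushing takes two machine steps, as a machine writes before it moves; the
   option types below add a location in which the top of a stack is tested. *)
Fixpoint location (c : cmd) : finType :=
  match c with
  | Push _ _ => bool
  | Pop _ => unit
  | Seq a b => (location a + location b)%type
  | If _ a b => option (location a + location b)
  | While _ a => option (location a)
  end.

Fixpoint entry (c : cmd) : location c :=
  match c with
  | Push _ _ => true
  | Pop _ => tt
  | Seq a b => inl (entry a)
  | If _ a b => None
  | While _ a => None
  end.

Definition act (v : var) (s : symbol) (d : move) (rd : reading) : action :=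
  [ffun i => if i == tape_of v then (s, d) else (rd i, Stay)].

Definition idle (rd : reading) : action := [ffun i => (rd i, Stay)].

(* The location [None] is the exit of the program. *)
Fixpoint next (c : cmd) : location c -> reading -> option (location c) * action :=
  match c with
  | Push v b => fun q rd =>
      if q then (Some false, act v (rd (tape_of v)) MoveLeft rd)
      else (None, act v (Some b) Stay rd)
  | Pop v => fun q rd => (None, act v None MoveRight rd)
  | Seq a b => fun q rd =>
      match q with
      | inl q => let: (o, ac) := next q rd in
          (Some (if o is Some q' then inl q' else inr (entry b)), ac)
      | inr q => let: (o, ac) := next q rd in (omap inr o, ac)
      end
  | If v a b => fun q rd =>
      match q with
      | None => (Some (Some (if rd (tape_of v) == Some true then inl (entry a)
                             else inr (entry b))), idle rd)
      | Some (inl q) => let: (o, ac) := next q rd in (omap (Some \o inl) o, ac)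
      | Some (inr q) => let: (o, ac) := next q rd in (omap (Some \o inr) o, ac)
      end
  | While v a => fun q rd =>
      match q with
      | None => (if rd (tape_of v) == Some true then Some (Some (entry a)) else None,
                 idle rd)
      | Some q => let: (o, ac) := next q rd in (Some o, ac)
      end
  end.

Definition compile (c : cmd) : machine :=
  @Machine 2 (option (location c)) (Some (entry c))
    (fun q rd => omap (fun q' => next q' rd) q).

Definition read_all (tps : tapes) : reading := [ffun i => tape_read (tps i)].

Definition perform (ac : action) (tps : tapes) : tapes :=
  [ffun i => tape_move (ac i).2 (tape_write (ac i).1 (tps i))].

(** The exit may be reached with steps to spare, so the count is an upper bound, as in [exec] and
    [run]. Speaking of locations of [c] and not of machine configurations allows runs of a
    subprogram to be embedded into runs of a larger one. *)
Inductive reaches (c : cmd) : option (location c) -> tapes -> tapes -> nat -> Prop :=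
| reaches_exit tps t : reaches None tps tps t
| reaches_step q tps tps' o ac t :
    next q (read_all tps) = (o, ac) -> reaches o (perform ac tps) tps' t ->
    reaches (Some q) tps tps' t.+1.

Lemma reaches_le c (o : option (location c)) tps tps' t t' :
  reaches o tps tps' t -> t <= t' -> reaches o tps tps' t'.
Proof.
move=> h; elim: h t' => {o tps tps' t} [tps t t' _|q tps tps' o ac t e _ ih [|t'] // le].
  exact: reaches_exit.
by apply: (reaches_step e); apply: ih.
Qed.

Lemma reaches_seql a b (o : option (location a)) tps1 tps2 tps3 t1 t2 :
  reaches o tps1 tps2 t1 -> reaches (c := a ;; b) (Some (inr (entry b))) tps2 tps3 t2 ->
  reaches (c := a ;; b) (Some (if o is Some q then inl q else inr (entry b)))
    tps1 tps3 (t1 + t2).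
Proof.
move=> h; elim: h => {o tps1 tps2 t1} [tps t h2|q tps tps' o ac t e _ ih h2].
  by apply: reaches_le h2 _; lia.
by rewrite addSn; apply: reaches_step (ih h2); rewrite /= e.
Qed.

(** This serves subprograms whose exit is the exit of the whole. The first half of a sequence and
    the body of a loop have their exit redirected, hence the separate [reaches_seql] and
    [reaches_while]. *)
Lemma reaches_lift c d (f : location c -> location d)
    (o : option (location c)) tps tps' t :
  (forall q rd, next (f q) rd = (omap f (next q rd).1, (next q rd).2)) ->
  reaches o tps tps' t -> reaches (omap f o) tps tps' t.
Proof.
move=> fP; elim=> {o tps tps' t} [tps t|q tps tps' o ac t e _ ih].
  exact: reaches_exit.
by apply: reaches_step ih; rewrite fP e.
Qed.

Lemma reaches_while v a (o : option (location a)) tps1 tps2 tps3 t1 t2 :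
  reaches o tps1 tps2 t1 -> reaches (c := While v a) (Some None) tps2 tps3 t2 ->
  reaches (c := While v a) (Some o) tps1 tps3 (t1 + t2).
Proof.
move=> h; elim: h => {o tps1 tps2 t1} [tps t h2|q tps tps' o ac t e _ ih h2].
  by apply: reaches_le h2 _; lia.
by rewrite addSn; apply: reaches_step (ih h2); rewrite /= e.
Qed.

(* Listed blanks are allowed around the stack, as popping leaves some behind. *)
Definition holds_stack (s : seq bool) (tp : tape) : Prop :=
  all (pred1 None) (cells_left tp) /\
  exists j, cells_right tp = map Some s ++ nseq j None.

Definition simulates (st : stacks) (tps : tapes) : Prop :=
  forall v, holds_stack (get v st) (tps (tape_of v)).

Lemma tape_of_eq (v w : var) (P : Prop) :
  (v = w -> P) -> (tape_of v == tape_of w = false -> v <> w -> P) -> P.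
Proof. by case: v; case: w => h1 h2; do [exact: h1 | exact: h2]. Qed.

Lemma get_set_same v s st : get v (set v s st) = s.
Proof. by case: st => [[? ?] ?]; case: v. Qed.

Lemma get_set_other v w s st : v <> w -> get v (set w s st) = get v st.
Proof. by case: st => [[? ?] ?]; case: v; case: w. Qed.

(** A machine writes on every tape in every step. Rewriting the symbol just read on a tape without
    listed cells to the right adds a listed blank, so an idle tape may change while its stack does
    not. *)
Lemma holds_stack_idle s tp :
  holds_stack s tp -> holds_stack s (tape_write (tape_read tp) tp).
Proof.
case: tp => l r [/= hl [j ->]]; split=> //=; case: s => [|b s] /=; last by exists j.
by case: j => [|j]; [exists 1 | exists j.+1].
Qed.

Lemma holds_stack_push s tp b :
  holds_stack s tp ->
  holds_stack (b :: s)
    (tape_write (Some b) (tape_move MoveLeft (tape_write (tape_read tp) tp))).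
Proof.
move/holds_stack_idle; case: (tape_write _ _) => l r [/= hl [j ->]].
by split; [case: l hl => [|? ?] //= /andP[] | exists j].
Qed.

Lemma holds_stack_pop s tp :
  holds_stack s tp ->
  holds_stack (behead s) (tape_move MoveRight (tape_write None tp)).
Proof.
case: tp => l r [/= hl [j ->]]; split=> //=; case: s => [|b s] /=; last by exists j.
by case: j => [|j]; [exists 0 | exists j].
Qed.

Lemma holds_stack_top s tp : holds_stack s tp -> (tape_read tp == Some true) = head false s.
Proof.
by case: tp => l r [_ [j /= ->]]; case: s => [|[] s] //; case: j.
Qed.

Lemma simulates_top st tps v :
  simulates st tps -> (read_all tps (tape_of v) == Some true) = top v st.
Proof. by move=> /(_ v) h; rewrite ffunE (holds_stack_top h). Qed.

Lemma simulates_idle st tps :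
  simulates st tps -> simulates st (perform (idle (read_all tps)) tps).
Proof. by move=> h v; rewrite !ffunE /=; apply: holds_stack_idle. Qed.

Lemma exec_reaches a st st' t tps :
  exec a st st' t -> simulates st tps ->
  exists2 tps', reaches (Some (entry a)) tps tps' t & simulates st' tps'.
Proof.
move=> h; elim: h tps => {a st st' t}.
- move=> v b st tps h; eexists.
    by apply: reaches_step => //; apply: reaches_step => //; apply: reaches_exit.
  move=> w; rewrite !ffunE; apply: (@tape_of_eq w v) => [->|-> ne].
    by rewrite eqxx get_set_same; apply: holds_stack_push.
  by rewrite get_set_other //=; do 2 apply: holds_stack_idle.
- move=> v st tps h; eexists.
    by apply: reaches_step => //; apply: reaches_exit.
  move=> w; rewrite !ffunE; apply: (@tape_of_eq w v) => [->|-> ne].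
    by rewrite eqxx get_set_same; apply: holds_stack_pop.
  by rewrite get_set_other //=; apply: holds_stack_idle.
- move=> a b st1 st2 st3 t1 t2 _ ih1 _ ih2 tps /ih1[tps1 r1 /ih2[tps2 r2 h2]].
  exists tps2 => //; apply: (reaches_seql r1).
  by apply: (@reaches_lift b (a ;; b) inr (Some _)) r2 => q rd /=; case: (next q rd).
- move=> v a b st1 st2 t _ ih tps h.
  have [tps' r h'] := ih _ (simulates_idle h); exists tps' => //.
  apply: reaches_step => //; rewrite (simulates_top v h).
  case: (top v st1) r => r.
    by apply: (@reaches_lift a (If v a b) (Some \o inl) (Some _)) r => q rd /=; case: (next q rd).
  by apply: (@reaches_lift b (If v a b) (Some \o inr) (Some _)) r => q rd /=; case: (next q rd).
- move=> v a st e tps h; exists (perform (idle (read_all tps)) tps).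
    by apply: reaches_step => //; rewrite (simulates_top v h) e; apply: reaches_exit.
  exact: simulates_idle.
- move=> v a st1 st2 st3 t1 t2 e _ ih1 _ ih2 tps h.
  have [tps1 r1 /ih2[tps2 r2 h2]] := ih1 _ (simulates_idle h).
  exists tps2 => //; apply: reaches_step => //; rewrite (simulates_top v h) e.
  exact: (reaches_while r1 r2).
- move=> a st1 st2 t t' _ ih le tps /ih[tps' r h].
  by exists tps' => //; apply: reaches_le r le.
Qed.

Lemma reaches_run c (o : option (location c)) tps tps' t :
  reaches o tps tps' t -> @run (compile c) t (o, tps) = Some (None, tps').
Proof.
elim=> {o tps tps' t} [tps [|t]|q tps tps' o ac t e _ ih] //=.
rewrite -/(read_all tps) e /=; exact: ih.
Qed.

Lemma word_until_blank_map s j : word_until_blank (map Some s ++ nseq j None) = s.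
Proof. by elim: s => [|b s /= ->] //; case: j. Qed.

Lemma exec_outputs a w out st1 st2 t :
  exec a (w, [::], [::]) (out, st1, st2) t -> outputs_within (compile a) t w out.
Proof.
move=> h.
have init : simulates (w, [::], [::]) (initial_config (compile a) w).2.
  move=> v; rewrite ffunE; case: v => /=; split=> //=; try by exists 0.
  by exists 0; rewrite cats0.
have [tps r h'] := exec_reaches h init.
exists (None, tps); first exact: reaches_run r.
by have [_ [j /= e]] := h' V0; rewrite /output /= e word_until_blank_map.
Qed.

(** * Moving codes between stacks *)

(* On the side stacks every bit is preceded by a 1 and a 0 marks the bottom, so that
   a code stored there can be taken back without knowing its type. *)
Definition marks (w : seq bool) : seq bool := flatten [seq [:: true; b] | b <- w].

Lemma marks_cat w1 w2 : marks (w1 ++ w2) = marks w1 ++ marks w2.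
Proof. by rewrite /marks map_cat flatten_cat. Qed.

(** * Types with self-delimiting codes *)

Definition save_bit : cmd :=
  If V0 (Pop V0 ;; Push V1 true ;; Push V1 true) (Pop V0 ;; Push V1 false ;; Push V1 true).

Lemma exec_save_bit b r0 r1 r2 :
  exec save_bit (b :: r0, r1, r2) (r0, true :: b :: r1, r2) 6.
Proof.
apply: exec_if; rewrite /top /=; case: b;
  by apply: (exec_seq (exec_pop _ _)); apply: (exec_seq (exec_push _ _ _) (exec_push _ _ _)).
Qed.

(** [save] is the parser of the type: it finds the end of the code while moving it to [V1], where it
    arrives reversed. The factor 8 covers the six steps of [save_bit] and the tests of the loops and
    branches that the parser itself contains. *)
Structure data := Data {
  carrier :> Type;
  enc : carrier -> seq bool;
  save : cmd;
  save_spec : forall a r0 r1 r2,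
    exec save (enc a ++ r0, r1, r2) (r0, marks (rev (enc a)) ++ r1, r2) (8 * size (enc a))
}.

Definition enc_bool (b : bool) : seq bool := [:: b].

Lemma save_bool_spec (b : bool) r0 r1 r2 :
  exec save_bit (enc_bool b ++ r0, r1, r2) (r0, marks (rev (enc_bool b)) ++ r1, r2)
    (8 * size (enc_bool b)).
Proof. exact: exec_weaken (exec_save_bit _ _ _ _) _. Qed.

Canonical bool_data := Data save_bool_spec.

Section ProdSeqOption.
Variables A B : data.

Definition enc_prod (p : A * B) : seq bool := enc p.1 ++ enc p.2.

Lemma save_prod_spec (p : A * B) r0 r1 r2 :
  exec (save A ;; save B) (enc_prod p ++ r0, r1, r2)
    (r0, marks (rev (enc_prod p)) ++ r1, r2) (8 * size (enc_prod p)).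
Proof.
rewrite /enc_prod -catA rev_cat marks_cat size_cat mulnDr.
by rewrite -[(marks _ ++ _) ++ r1]catA; apply: exec_seq (save_spec _ _ _ _) (save_spec _ _ _ _).
Qed.

Canonical prod_data := Data save_prod_spec.

Lemma encode_seq_cons (x : A) s :
  encode_seq (@enc A) (x :: s) = true :: enc x ++ encode_seq (@enc A) s.
Proof. by rewrite /encode_seq /= -catA. Qed.

Lemma save_seq_spec (s : seq A) r0 r1 r2 :
  exec (While V0 (save_bit ;; save A) ;; save_bit) (encode_seq (@enc A) s ++ r0, r1, r2)
    (r0, marks (rev (encode_seq (@enc A) s)) ++ r1, r2)
    (8 * size (encode_seq (@enc A) s)).
Proof.
have loop r : exec (While V0 (save_bit ;; save A)) (encode_seq (@enc A) s ++ r0, r, r2)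
    (false :: r0, marks (rev (flatten [seq true :: enc a | a <- s])) ++ r, r2)
    (8 * size (flatten [seq true :: enc a | a <- s]) + 1).
  elim: s r => [|x s ih] r; first exact: exec_while_stop.
  rewrite encode_seq_cons cat_cons -catA.
  apply: exec_weaken (exec_while_step _ (exec_seq (exec_save_bit _ _ _ _) (save_spec _ _ _ _)) _) _.
  - by [].
  - have := ih (marks (rev (enc x)) ++ [:: true, true & r]).
    by rewrite /= -cat_cons rev_cat rev_cons -cats1 !marks_cat -!catA; apply.
  - by rewrite /= size_cat; lia.
have -> : marks (rev (encode_seq (@enc A) s)) =
    [:: true, false & marks (rev (flatten [seq true :: enc a | a <- s]))].
  by rewrite /encode_seq cats1 rev_rcons.
apply: exec_weaken (exec_seq (loop _) (exec_save_bit _ _ _ _)) _.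
by rewrite /encode_seq size_cat /=; lia.
Qed.

Canonical seq_data := Data save_seq_spec.

Lemma save_option_spec (o : option A) r0 r1 r2 :
  exec (If V0 (save_bit ;; save A) save_bit) (encode_option (@enc A) o ++ r0, r1, r2)
    (r0, marks (rev (encode_option (@enc A) o)) ++ r1, r2)
    (8 * size (encode_option (@enc A) o)).
Proof.
case: o => [x|] /=; last first.
  by apply: (@exec_weaken _ _ _ 7) => //; apply: exec_if; apply: exec_save_bit.
rewrite rev_cons -cats1 marks_cat -catA.
apply: (@exec_weaken _ _ _ (6 + 8 * size (enc x)).+1); last by lia.
by apply: exec_if; apply: exec_seq (exec_save_bit _ _ _ _) (save_spec _ _ _ _).
Qed.

Canonical option_data := Data save_option_spec.

End ProdSeqOption.

(** Parsing only has to find the end of a code, so a type mapped into a coded type can share its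
    parser. *)
Lemma save_preim_spec (B : data) (T : Type) (h : T -> B) (a : T) r0 r1 r2 :
  exec (save B) (enc (h a) ++ r0, r1, r2) (r0, marks (rev (enc (h a))) ++ r1, r2)
    (8 * size (enc (h a))).
Proof. exact: save_spec. Qed.

Canonical nat_data := Data (save_preim_spec (B := seq_data bool_data) binary).

(** The alias selects a second, unary code through the canonical structures. A loop repeated as
    often as such a number says is polynomial in its code; for a binary number it could be
    exponential. *)
Definition unat := nat.
Definition unary (n : unat) : seq bool := nseq n true.

Canonical unat_data := Data (save_preim_spec (B := seq_data bool_data) unary).

(** * Parking, restoring, dropping and copying codes *)

Definition flip_mark (v w : var) (b : bool) : cmd :=
  Pop v ;; Push w b ;; Push w true.

Definition transfer (v w : var) : cmd :=
  Push w false ;; While v (Pop v ;; If v (flip_mark v w true) (flip_mark v w false)) ;; Pop v.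

Lemma exec_transfer12 s r0 r1 r2 :
  exec (transfer V1 V2) (r0, marks s ++ false :: r1, r2)
    (r0, r1, marks (rev s) ++ false :: r2) (8 * size s + 8).
Proof.
have loop r : exec (While V1 (Pop V1 ;; If V1 (flip_mark V1 V2 true) (flip_mark V1 V2 false)))
    (r0, marks s ++ false :: r1, r) (r0, false :: r1, marks (rev s) ++ r) (8 * size s + 1).
  elim: s r => [|b s ih] r; first exact: exec_while_stop.
  apply: exec_weaken (exec_while_step _ (exec_seq (exec_pop _ _) (exec_if
    (st2 := (r0, marks s ++ false :: r1, true :: b :: r)) (t := 5) _)) _) _.
  - by [].
  - by case: b; apply: (exec_seq (exec_pop _ _)); apply: (exec_seq (exec_push _ _ _) (exec_push _ _ _)).
  - have := ih (true :: b :: r).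
    by rewrite rev_cons -cats1 marks_cat -catA; apply.
  - by rewrite /=; lia.
eapply exec_weaken;
  first by eapply exec_seq; [exact: exec_push | eapply exec_seq; [exact: loop | exact: exec_pop]].
by lia.
Qed.

Lemma exec_transfer21 s r0 r1 r2 :
  exec (transfer V2 V1) (r0, r1, marks s ++ false :: r2)
    (r0, marks (rev s) ++ false :: r1, r2) (8 * size s + 8).
Proof.
have loop r : exec (While V2 (Pop V2 ;; If V2 (flip_mark V2 V1 true) (flip_mark V2 V1 false)))
    (r0, r, marks s ++ false :: r2) (r0, marks (rev s) ++ r, false :: r2) (8 * size s + 1).
  elim: s r => [|b s ih] r; first exact: exec_while_stop.
  apply: exec_weaken (exec_while_step _ (exec_seq (exec_pop _ _) (exec_if
    (st2 := (r0, true :: b :: r, marks s ++ false :: r2)) (t := 5) _)) _) _.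
  - by [].
  - by case: b; apply: (exec_seq (exec_pop _ _)); apply: (exec_seq (exec_push _ _ _) (exec_push _ _ _)).
  - have := ih (true :: b :: r).
    by rewrite rev_cons -cats1 marks_cat -catA; apply.
  - by rewrite /=; lia.
eapply exec_weaken;
  first by eapply exec_seq; [exact: exec_push | eapply exec_seq; [exact: loop | exact: exec_pop]].
by lia.
Qed.

Definition hold (A : data) : cmd := Push V1 false ;; save A.

Lemma exec_hold (A : data) (a : A) r0 r1 r2 :
  exec (hold A) (enc a ++ r0, r1, r2) (r0, marks (rev (enc a)) ++ false :: r1, r2)
    (8 * size (enc a) + 8).
Proof.
eapply exec_weaken; first by eapply exec_seq; [exact: exec_push | exact: save_spec].
by lia.
Qed.

Definition release : cmd :=
  While V1 (Pop V1 ;; If V1 (Pop V1 ;; Push V0 true) (Pop V1 ;; Push V0 false)) ;; Pop V1.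

Lemma exec_release s r0 r1 r2 :
  exec release (r0, marks (rev s) ++ false :: r1, r2) (s ++ r0, r1, r2) (8 * size s + 8).
Proof.
rewrite -{2 3}[s]revK size_rev; move: (rev s) => {}s.
have loop : exec (While V1 (Pop V1 ;; If V1 (Pop V1 ;; Push V0 true) (Pop V1 ;; Push V0 false)))
    (r0, marks s ++ false :: r1, r2) (rev s ++ r0, false :: r1, r2) (8 * size s + 1).
  elim: s r0 => [|b s ih] r; first exact: exec_while_stop.
  apply: exec_weaken (exec_while_step _ (exec_seq (exec_pop _ _) (exec_if
    (st2 := (b :: r, marks s ++ false :: r1, r2)) (t := 3) _)) _) _.
  - by [].
  - by case: b; apply: (exec_seq (exec_pop _ _) (exec_push _ _ _)).
  - have := ih (b :: r).
    by rewrite rev_cons -cats1 -catA; apply.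
  - by rewrite /=; lia.
apply: exec_weaken (exec_seq loop (exec_pop _ _)) _.
by lia.
Qed.

Definition discard : cmd := While V1 (Pop V1 ;; Pop V1) ;; Pop V1.

Lemma exec_discard s r0 r1 r2 :
  exec discard (r0, marks (rev s) ++ false :: r1, r2) (r0, r1, r2) (8 * size s + 8).
Proof.
rewrite -(size_rev s); move: (rev s) => {}s.
have loop : exec (While V1 (Pop V1 ;; Pop V1))
    (r0, marks s ++ false :: r1, r2) (r0, false :: r1, r2) (8 * size s + 1).
  elim: s => [|b s ih]; first exact: exec_while_stop.
  eapply exec_weaken.
    apply: exec_while_step ih => //.
    by eapply exec_seq; exact: exec_pop.
  by rewrite /=; lia.
apply: exec_weaken (exec_seq loop (exec_pop _ _)) _.
by lia.
Qed.

Definition copy_bit (b : bool) : cmd :=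
  Pop V1 ;; Push V0 b ;; Push V2 b ;; Push V2 true.

(** Each bit taken from [V1] goes both to [V0] and to [V2]. The copy on [V2] has the order opposite
    to the one [release] expects, and the transfer back to [V1] reverses it. *)
Definition dup (A : data) : cmd :=
  hold A ;; Push V2 false ;;
  (While V1 (Pop V1 ;; If V1 (copy_bit true) (copy_bit false)) ;; Pop V1) ;;
  transfer V2 V1 ;; release.

Lemma exec_dup (A : data) (a : A) r0 r1 r2 :
  exec (dup A) (enc a ++ r0, r1, r2) (enc a ++ enc a ++ r0, r1, r2) (40 * size (enc a) + 40).
Proof.
have loop s r r' : exec (While V1 (Pop V1 ;; If V1 (copy_bit true) (copy_bit false)))
    (r, marks s ++ false :: r1, r') (rev s ++ r, false :: r1, marks (rev s) ++ r')
    (10 * size s + 1).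
  elim: s r r' => [|b s ih] r r'; first exact: exec_while_stop.
  apply: exec_weaken (exec_while_step _ (exec_seq (exec_pop _ _) (exec_if
    (st2 := (b :: r, marks s ++ false :: r1, true :: b :: r')) (t := 7) _)) _) _.
  - by [].
  - by case: b; apply: (exec_seq (exec_pop _ _)); apply: (exec_seq (exec_push _ _ _));
      apply: (exec_seq (exec_push _ _ _) (exec_push _ _ _)).
  - have := ih (b :: r) (true :: b :: r').
    by rewrite rev_cons -cats1 marks_cat -!catA; apply.
  - by rewrite /=; lia.
eapply exec_weaken.
  eapply exec_seq; first exact: exec_hold.
  eapply exec_seq; first exact: exec_push.
  eapply exec_seq; first by eapply exec_seq; [exact: loop | exact: exec_pop].
  eapply exec_seq; last exact: exec_release.
  by rewrite /= revK; apply: exec_transfer21.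
by rewrite size_rev; lia.
Qed.

(** * Functions computable in polynomial time *)

(** The base is at least 2 even for [n = 0], so constants and sums are absorbed by a larger exponent
    and no leading coefficient has to be carried along. *)
Definition poly_bounded (b : nat -> nat) : Prop :=
  exists d, forall n, b n <= (n + 2) ^ d.

Lemma poly_bounded_le f g : (forall n, f n <= g n) -> poly_bounded g -> poly_bounded f.
Proof. by move=> le [d h]; exists d => n; apply: leq_trans (le n) (h n). Qed.

Lemma leq_expn2r e m n : m <= n -> m ^ e <= n ^ e.
Proof. by case: e => [|e] le //; rewrite leq_exp2r. Qed.

Lemma poly_bounded_const c : poly_bounded (fun=> c).
Proof.
exists c => n; apply: leq_trans (ltnW (ltn_expl c (isT : 1 < 2))) _.
by apply: leq_expn2r; lia.
Qed.

Lemma poly_bounded_id : poly_bounded (fun n => n).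
Proof. by exists 1 => n; rewrite expn1; lia. Qed.

Lemma poly_bounded_add f g :
  poly_bounded f -> poly_bounded g -> poly_bounded (fun n => f n + g n).
Proof.
move=> [d1 h1] [d2 h2]; exists (d1 + d2).+1 => n.
apply: leq_trans (leq_add (h1 n) (h2 n)) _; rewrite expnS expnD.
have : 0 < (n + 2) ^ d1 by rewrite expn_gt0 addn2.
have : 0 < (n + 2) ^ d2 by rewrite expn_gt0 addn2.
by nia.
Qed.

Lemma poly_bounded_mul f g :
  poly_bounded f -> poly_bounded g -> poly_bounded (fun n => f n * g n).
Proof.
move=> [d1 h1] [d2 h2]; exists (d1 + d2) => n.
by rewrite expnD; apply: leq_mul.
Qed.

Lemma poly_bounded_comp f g :
  poly_bounded f -> poly_bounded g -> poly_bounded (fun n => f (g n)).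
Proof.
(* The two extra powers absorb the 2 in the base of the outer bound:
   [(n + 2) ^ d2 + 2 <= (n + 2) ^ d2.+2]. *)
move=> [d1 h1] [d2 h2]; exists (d2.+2 * d1) => n.
apply: leq_trans (h1 _) _; rewrite expnM; apply: leq_expn2r.
have := h2 n; rewrite 2!expnS.
have : 0 < (n + 2) ^ d2 by rewrite expn_gt0 addn2.
by nia.
Qed.

Ltac prove_poly_bounded := solve [repeat first
  [ assumption | apply: poly_bounded_id | apply: poly_bounded_const
  | apply: poly_bounded_add | apply: poly_bounded_mul
  | match goal with H : poly_bounded ?f |- poly_bounded (fun n => ?f (@?g n)) =>
      apply: (@poly_bounded_comp f g H) end ]].

(* The code of the argument is replaced in place by that of the value, so that
   these programs compose although only three stacks are available. *)
Definition polytime (A B : data) (f : A -> B) : Prop :=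
  exists c b, poly_bounded b /\
    forall a n r0 r1 r2, size (enc a) <= n ->
      exec c (enc a ++ r0, r1, r2) (enc (f a) ++ r0, r1, r2) (b n).

Lemma polytime_size (A B : data) (f : A -> B) : polytime f ->
  exists2 b, poly_bounded b & forall a n, size (enc a) <= n -> size (enc (f a)) <= b n.
Proof.
move=> [c [b [pb h]]]; exists (fun n => n + b n); first by prove_poly_bounded.
move=> a n le; have := exec_height (h a n [::] [::] [::] le).
by rewrite /height /= !cats0; lia.
Qed.

Lemma eq_polytime (A B : data) (f g : A -> B) : f =1 g -> polytime f -> polytime g.
Proof. by move=> e [c [b [pb h]]]; exists c, b; split=> // a n *; rewrite -e; apply: h. Qed.

(** Programs see codes and not types, so reading a number as its list of digits, or the converse,
    takes no computation. *)
Lemma polytime_same_code (A B C : data) (f : A -> B) (g : A -> C) :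
  (forall a, enc (f a) = enc (g a)) -> polytime f -> polytime g.
Proof. by move=> e [c [b [pb h]]]; exists c, b; split=> // a n *; rewrite -e; apply: h. Qed.

Lemma polytime_id (A : data) : polytime (fun a : A => a).
Proof.
(* The language has no empty command; a push undone by a pop replaces it. *)
exists (Push V0 true ;; Pop V0), (fun=> 3); split; first by prove_poly_bounded.
by move=> *; apply: (exec_seq (exec_push _ _ _) (exec_pop _ _)).
Qed.

Lemma polytime_comp (A B C : data) (g : B -> C) (f : A -> B) :
  polytime g -> polytime f -> polytime (fun a => g (f a)).
Proof.
move=> [cg [bg [pg hg]]] pf; have [s ps hs] := polytime_size pf.
case: pf => [cf [bf [pf hf]]].
exists (cf ;; cg), (fun n => bf n + bg (s n)); split; first by prove_poly_bounded.
by move=> a n r0 r1 r2 le; apply: exec_seq (hf _ _ _ _ _ le) (hg _ _ _ _ _ (hs _ _ le)).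
Qed.

Lemma polytime_pair (E A B : data) (f : E -> A) (g : E -> B) :
  polytime f -> polytime g -> polytime (fun e => (f e, g e)).
Proof.
move=> pf; have [s ps hs] := polytime_size pf.
case: pf => [cf [bf [pf hf]]] [cg [bg [pg hg]]].
exists (dup E ;; cf ;; hold A ;; cg ;; release),
  (fun n => (40 * n + 40) + (bf n + ((8 * s n + 8) + (bg n + (8 * s n + 8))))).
split; first by prove_poly_bounded.
move=> e n r0 r1 r2 le; have le2 := hs _ _ le.
apply: exec_seq; first by apply: exec_weaken (exec_dup _ _ _ _) _; lia.
apply: exec_seq; first exact: hf.
apply: exec_seq; first by apply: exec_weaken (exec_hold _ _ _ _) _; lia.
apply: exec_seq; first exact: hg.
by rewrite /= /enc_prod -catA; apply: exec_weaken (exec_release _ _ _ _) _; lia.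
Qed.

Lemma polytime_proj1 (A B : data) : polytime (fun p : A * B => p.1).
Proof.
exists (hold A ;; hold B ;; discard ;; release),
  (fun n => (8 * n + 8) + ((8 * n + 8) + ((8 * n + 8) + (8 * n + 8)))).
split; first by prove_poly_bounded.
move=> [a b] n r0 r1 r2; rewrite /= /enc_prod /= size_cat -catA => le.
apply: exec_seq; first by apply: exec_weaken (exec_hold _ _ _ _) _; lia.
apply: exec_seq; first by apply: exec_weaken (exec_hold _ _ _ _) _; lia.
apply: exec_seq; first by apply: exec_weaken (exec_discard _ _ _ _) _; lia.
by apply: exec_weaken (exec_release _ _ _ _) _; lia.
Qed.

Lemma polytime_proj2 (A B : data) : polytime (fun p : A * B => p.2).
Proof.
exists (hold A ;; discard), (fun n => (8 * n + 8) + (8 * n + 8)).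
split; first by prove_poly_bounded.
move=> [a b] n r0 r1 r2; rewrite /= /enc_prod /= size_cat -catA => le.
apply: exec_seq; first by apply: exec_weaken (exec_hold _ _ _ _) _; lia.
by apply: exec_weaken (exec_discard _ _ _ _) _; lia.
Qed.

Lemma polytime_fst (E A B : data) (f : E -> A * B) :
  polytime f -> polytime (fun e => (f e).1).
Proof. exact: polytime_comp (@polytime_proj1 A B). Qed.

Lemma polytime_snd (E A B : data) (f : E -> A * B) :
  polytime f -> polytime (fun e => (f e).2).
Proof. exact: polytime_comp (@polytime_proj2 A B). Qed.

Fixpoint push_all (s : seq bool) : cmd :=
  if s is b :: s' then push_all s' ;; Push V0 b else Push V0 true ;; Pop V0.

Lemma exec_push_all s r0 r1 r2 :
  exec (push_all s) (r0, r1, r2) (s ++ r0, r1, r2) (2 * size s + 3).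
Proof.
elim: s => [|b s ih] /=; first by apply: (exec_seq (exec_push _ _ _) (exec_pop _ _)).
by apply: exec_weaken (exec_seq ih (exec_push _ _ _)) _; lia.
Qed.

Lemma polytime_const (E A : data) (a : A) : polytime (fun _ : E => a).
Proof.
exists (hold E ;; discard ;; push_all (enc a)),
  (fun n => (8 * n + 8) + ((8 * n + 8) + (2 * size (enc a) + 3))).
split; first by prove_poly_bounded.
move=> e n r0 r1 r2 le.
apply: exec_seq; first by apply: exec_weaken (exec_hold _ _ _ _) _; lia.
apply: exec_seq; first by apply: exec_weaken (exec_discard _ _ _ _) _; lia.
exact: exec_push_all.
Qed.

Lemma polytime_if (E A : data) (b : E -> bool) (f g : E -> A) :
  polytime b -> polytime f -> polytime g -> polytime (fun e => if b e then f e else g e).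
Proof.
move=> pb [cf [bf [pf hf]]] [cg [bg [pg hg]]].
have [c [t [pt h]]] := polytime_pair pb (polytime_id E).
exists (c ;; If V0 (Pop V0 ;; cf) (Pop V0 ;; cg)), (fun n => t n + (1 + (bf n + bg n)).+1).
split.
  by apply: (@poly_bounded_le _ (fun n => t n + (2 + (bf n + bg n)))) => [n|]; [lia | prove_poly_bounded].
move=> e n r0 r1 r2 le; apply: exec_seq; first exact: h.
apply: exec_if; rewrite /top /=; case: (b e).
  apply: exec_seq; first exact: exec_pop.
  by apply: exec_weaken (hf _ _ _ _ _ le) _; lia.
apply: exec_seq; first exact: exec_pop.
by apply: exec_weaken (hg _ _ _ _ _ le) _; lia.
Qed.

(** The first bit of the code of a list tells whether it is empty. Once it is popped from a nonempty
    list, what remains, followed by the code of [e], already is the code of [(x, (s, e))]; hence the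
    program for [g] is taken with its arguments in this order. *)
Lemma polytime_case_seq (E A B : data) (l : E -> seq A) (f : E -> B) (g : E -> A -> seq A -> B) :
  polytime l -> polytime f ->
  polytime (fun p : E * (A * seq A) => g p.1 p.2.1 p.2.2) ->
  polytime (fun e => if l e is x :: s then g e x s else f e).
Proof.
move=> pl [cf [bf [pf hf]]] pg.
have [cg [bg [{}pg hg]]] : polytime (fun p : A * (seq A * E) => g p.2.2 p.1 p.2.1).
  apply: (polytime_comp (f := fun p : A * (seq A * E) => (p.2.2, (p.1, p.2.1))) pg).
  apply: polytime_pair.
    by do 2 apply: polytime_snd; apply: polytime_id.
  apply: polytime_pair; first by apply: polytime_fst; apply: polytime_id.
  by apply: polytime_fst; apply: polytime_snd; apply: polytime_id.
have pc := polytime_pair pl (polytime_id E).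
have [s ps hs] := polytime_size pc.
have [c [t [pt h]]] := pc.
exists (c ;; If V0 (Pop V0 ;; cg) (Pop V0 ;; cf)), (fun n => t n + (1 + (bf n + bg (s n))).+1).
split.
  by apply: (@poly_bounded_le _ (fun n => t n + (2 + (bf n + bg (s n))))) => [n|]; [lia | prove_poly_bounded].
move=> e n r0 r1 r2 le; apply: exec_seq; first exact: h.
have le1 := hs _ _ le; apply: exec_if; move: le1.
rewrite /= /enc_prod /top /=; case: (l e) => [|x w] /= le2.
  apply: exec_seq; first exact: exec_pop.
  by apply: exec_weaken (hf _ _ _ _ _ le) _; lia.
apply: exec_seq; first exact: exec_pop.
have le3 : size (enc (x, (w, e))) <= s n.
  by move: le2; rewrite /= /enc_prod /= /encode_seq !size_cat /=; lia.
have := hg _ _ r0 r1 r2 le3; rewrite /= /enc_prod /= /encode_seq -!catA => hh.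
by apply: exec_weaken hh _; lia.
Qed.

Lemma polytime_case_option (E A B : data) (o : E -> option A) (f : E -> B) (g : E -> A -> B) :
  polytime o -> polytime f -> polytime (fun p : E * A => g p.1 p.2) ->
  polytime (fun e => if o e is Some x then g e x else f e).
Proof.
move=> po [cf [bf [pf hf]]] pg.
have [cg [bg [{}pg hg]]] : polytime (fun p : A * E => g p.2 p.1).
  apply: (polytime_comp (f := fun p : A * E => (p.2, p.1)) pg).
  by apply: polytime_pair; [apply: polytime_proj2 | apply: polytime_proj1].
have pc := polytime_pair po (polytime_id E).
have [s ps hs] := polytime_size pc.
have [c [t [pt h]]] := pc.
exists (c ;; If V0 (Pop V0 ;; cg) (Pop V0 ;; cf)), (fun n => t n + (1 + (bf n + bg (s n))).+1).
split.
  by apply: (@poly_bounded_le _ (fun n => t n + (2 + (bf n + bg (s n))))) => [n|]; [lia | prove_poly_bounded].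
move=> e n r0 r1 r2 le; apply: exec_seq; first exact: h.
have le1 := hs _ _ le; apply: exec_if; move: le1.
rewrite /= /enc_prod /top /=; case: (o e) => [x|] /= le2; last first.
  apply: exec_seq; first exact: exec_pop.
  by apply: exec_weaken (hf _ _ _ _ _ le) _; lia.
apply: exec_seq; first exact: exec_pop.
have le3 : size (enc (x, e)) <= s n.
  by move: le2; rewrite /= /enc_prod /= !size_cat /=; lia.
have := hg _ _ r0 r1 r2 le3; rewrite /= /enc_prod /= -!catA => hh.
by apply: exec_weaken hh _; lia.
Qed.

(** * Constructors, and folds with bounded accumulators *)

Lemma enc_cons (A : data) (x : A) (s : seq A) : enc (x :: s) = true :: enc x ++ enc s.
Proof. exact: encode_seq_cons. Qed.

Lemma enc_pair (A B : data) (a : A) (b : B) : enc (a, b) = enc a ++ enc b.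
Proof. by []. Qed.

Lemma polytime_cons (E A : data) (f : E -> A) (l : E -> seq A) :
  polytime f -> polytime l -> polytime (fun e => f e :: l e).
Proof.
move=> pf pl; have [c [t [pt h]]] := polytime_pair pf pl.
exists (c ;; Push V0 true), (fun n => t n + 2); split; first by prove_poly_bounded.
move=> e n r0 r1 r2 le; apply: exec_seq; first exact: h.
by rewrite enc_cons; apply: exec_push.
Qed.

Lemma polytime_Some (E A : data) (f : E -> A) :
  polytime f -> polytime (fun e => Some (f e)).
Proof.
move=> [c [t [pt h]]].
exists (c ;; Push V0 true), (fun n => t n + 2); split; first by prove_poly_bounded.
by move=> e n r0 r1 r2 le; apply: exec_seq; [apply: h | apply: exec_push].
Qed.

(* The element is parked below the rest of the list, which then moves on to V2. *)
Definition fold_body (A : data) (c : cmd) : cmd :=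
  Pop V0 ;; hold A ;; hold (seq_data A) ;; transfer V1 V2 ;; release ;;
  c ;; transfer V2 V1 ;; release.

(** The cost of a round depends on the accumulator it meets, so [k] must bound those of all
    prefixes. Besides [c], a round makes six moves of codes of size at most [m], each in [8 * m + 8]
    steps, plus a pop and a loop test: [48 * m + 50]. *)
Lemma exec_fold (A S : data) (c : cmd) (b : nat -> nat) (f : S -> A -> S) (m k : nat) :
  (forall x a n r0 r1 r2, size (enc (x, a)) <= n ->
     exec c (enc x ++ enc a ++ r0, r1, r2) (enc (f a x) ++ r0, r1, r2) (b n)) ->
  forall (s : seq A) (a : S) r0 r1 r2,
  size (enc s) <= m -> (forall i, size (enc (foldl f a (take i s))) <= k) ->
  exec (While V0 (fold_body A c)) (enc s ++ enc a ++ r0, r1, r2)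
    (false :: enc (foldl f a s) ++ r0, r1, r2) (size s * (48 * m + 50 + b (m + k)) + 1).
Proof.
move=> h; elim=> [|x s ih] a r0 r1 r2 lem lek; first exact: exec_while_stop.
move: lem; rewrite enc_cons cat_cons -catA => lem0.
have lem : size (enc x) + size (enc s) < m by rewrite -size_cat.
have lea : size (enc a) <= k := lek 0.
have leS : size (enc s) <= m by lia.
have lekS i : size (enc (foldl f (f a x) (take i s))) <= k by apply: (lek i.+1).
eapply exec_weaken.
  apply: exec_while_step; last exact: (ih (f a x) r0 r1 r2 leS lekS); first by [].
  eapply exec_seq; first exact: exec_pop.
  eapply exec_seq; first exact: (exec_hold x).
  eapply exec_seq; first exact: (@exec_hold (seq_data A) s).
  eapply exec_seq; first exact: exec_transfer12.
  eapply exec_seq; first exact: exec_release.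
  eapply exec_seq; first by apply: (h x a (m + k)); rewrite enc_pair size_cat; lia.
  eapply exec_seq; first exact: exec_transfer21.
  by rewrite revK; exact: exec_release.
by rewrite !size_rev [size (_ :: _)]/=; lia.
Qed.

Lemma size_leq_enc (A : data) (s : seq A) : size s <= size (enc s).
Proof. elim: s => [|x s ih] //; rewrite enc_cons; apply: leq_ltn_trans ih _.
by rewrite /= ltnS size_cat leq_addl. Qed.

Lemma polytime_foldl_stateful (X A S : data) (l : X -> seq A) (a0 : X -> S)
    (f : S -> A -> S) (q : nat -> nat) :
  polytime (fun p : A * S => f p.2 p.1) -> poly_bounded q ->
  (forall x n i, size (enc x) <= n -> size (enc (foldl f (a0 x) (take i (l x)))) <= q n) ->
  polytime l -> polytime a0 ->
  polytime (fun x => foldl f (a0 x) (l x)).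
Proof.
move=> [c [b [pb h]]] pq hq pl pa.
have [m pm hm] := polytime_size pl.
have [c1 [t [pt h1]]] := polytime_pair pl pa.
exists (c1 ;; While V0 (fold_body A c) ;; Pop V0),
  (fun n => t n + ((m n * (48 * m n + 50 + b (m n + q n)) + 1) + 1)).
split; first by prove_poly_bounded.
move=> x n r0 r1 r2 le; apply: exec_seq; first exact: h1.
eapply exec_seq; last first.
  exact: (@exec_pop V0 (false :: enc (foldl f (a0 x) (l x)) ++ r0, r1, r2)).
rewrite enc_pair -catA.
eapply exec_weaken.
  apply: (@exec_fold A S c b f (m n) (q n)).
  - by move=> y a n' r0' r1' r2' le'; have := h (y, a) n' r0' r1' r2' le'; rewrite enc_pair -catA.
  - exact: hm.
  - by move=> i; apply: hq.
rewrite leq_add2r leq_mul2r; apply/orP; right.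
exact: leq_trans (size_leq_enc _) (hm _ _ le).
Qed.

(** The loop body has access to the element and the accumulator only, so the environment travels
    inside the accumulator. Sizes are constrained only for accumulators that occur, which matters
    when a step could enlarge others too much. *)
Lemma polytime_foldl_reachable (E A S : data) (f : E -> S -> A -> S) (l : E -> seq A)
    (a0 : E -> S) (q : nat -> nat) :
  polytime (fun p : E * S * A => f p.1.1 p.1.2 p.2) -> poly_bounded q ->
  (forall e n i, size (enc e) <= n -> size (enc (foldl (f e) (a0 e) (take i (l e)))) <= q n) ->
  polytime l -> polytime a0 -> polytime (fun e => foldl (f e) (a0 e) (l e)).
Proof.
move=> pf pq hq pl pa; pose F (st : S * E) x := (f st.2 st.1 x, st.2).
have FE e s a : foldl F (a, e) s = (foldl (f e) a s, e) by elim: s a => //= x s ih a; apply: ih.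
apply: (@eq_polytime _ _ (fun e => (foldl F (a0 e, e) (l e)).1)) => [e|]; first by rewrite FE.
apply: polytime_fst; apply: (@polytime_foldl_stateful _ _ _ _ _ _ (fun n => q n + n)) => //.
- apply: polytime_pair; last by do 2 apply: polytime_snd; apply: polytime_id.
  apply: (polytime_comp (f := fun p : A * (S * E) => (p.2.2, p.2.1, p.1)) pf).
  apply: polytime_pair; last exact: polytime_proj1.
  apply: polytime_pair; first exact: polytime_snd (polytime_proj2 _ _).
  exact: polytime_fst (polytime_proj2 _ _).
- by prove_poly_bounded.
- by move=> e n i le; rewrite FE enc_pair size_cat leq_add // hq.
- exact: polytime_pair pa (polytime_id _).
Qed.

(** If the growth per step does not depend on the accumulator, it sums to at most the number of
    steps times [g], which excludes repeated doubling. *)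
Lemma polytime_foldl (E A S : data) (f : E -> S -> A -> S) (l : E -> seq A)
    (a0 : E -> S) (g : nat -> nat) :
  polytime (fun p : E * S * A => f p.1.1 p.1.2 p.2) -> poly_bounded g ->
  (forall e a x n, size (enc e) + size (enc x) <= n ->
     size (enc (f e a x)) <= size (enc a) + g n) ->
  polytime l -> polytime a0 -> polytime (fun e => foldl (f e) (a0 e) (l e)).
Proof.
move=> pf pg hg pl pa.
have [m pm hm] := polytime_size pl; have [k pk hk] := polytime_size pa.
apply: (@polytime_foldl_reachable _ _ _ _ _ _ (fun n => k n + m n * g (n + m n))) => //.
  by prove_poly_bounded.
move=> e n i le.
have bound (s : seq A) a j : size (enc s) <= m n ->
    size (enc (foldl (f e) a (take j s))) <= size (enc a) + size s * g (n + m n).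
  elim: s a j => [|x s ih] a [|j] lem; rewrite ?leq_addr //.
  move: lem; rewrite enc_cons -cat_cons size_cat => lem.
  have le1 : size (enc e) + size (enc x) <= n + m n.
    by apply: leq_add => //; apply: leq_trans lem; apply: leq_trans (leq_addr _ _).
  have le2 : size (enc s) <= m n by apply: leq_trans lem; apply: leq_addl.
  apply: leq_trans (ih _ j le2) _; have := hg e a x _ le1.
  by rewrite [size (x :: s)]/= mulSn addnA leq_add2r.
apply: leq_trans (bound _ _ _ (hm _ _ le)) (leq_add (hk _ _ le) _).
by rewrite leq_mul2r (leq_trans (size_leq_enc _) (hm _ _ le)) orbT.
Qed.

(** * Boolean connectives and operations on lists *)

Lemma polytime_head (E A : data) (x0 : A) (l : E -> seq A) :
  polytime l -> polytime (fun e => head x0 (l e)).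
Proof.
move=> pl.
apply: (@eq_polytime _ _ (fun e => if l e is x :: s then x else x0)) => [e|].
  by case: (l e).
apply: (polytime_case_seq (g := fun _ x _ => x)) => //; first exact: polytime_const.
exact: polytime_fst (polytime_proj2 _ _).
Qed.

Lemma polytime_ohead (E A : data) (l : E -> seq A) :
  polytime l -> polytime (fun e => ohead (l e)).
Proof.
move=> pl.
apply: (@eq_polytime _ _ (fun e => if l e is x :: s then Some x else None)) => [e|].
  by case: (l e).
apply: (polytime_case_seq (g := fun _ x _ => Some x)) => //; first exact: polytime_const.
exact: polytime_Some (polytime_fst (polytime_proj2 _ _)).
Qed.

Lemma polytime_behead (E A : data) (l : E -> seq A) :
  polytime l -> polytime (fun e => behead (l e)).
Proof.
move=> pl.
apply: (@eq_polytime _ _ (fun e => if l e is x :: s then s else [::])) => [e|].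
  by case: (l e).
apply: (polytime_case_seq (g := fun _ _ s => s)) => //; first exact: polytime_const.
exact: polytime_snd (polytime_proj2 _ _).
Qed.

Lemma size_enc_behead (A : data) (s : seq A) : size (enc (behead s)) <= size (enc s).
Proof. by case: s => [|x s] //; rewrite enc_cons -cat_cons size_cat leq_addl. Qed.

Lemma polytime_nilp (E A : data) (l : E -> seq A) :
  polytime l -> polytime (fun e => nilp (l e)).
Proof.
move=> pl.
apply: (@eq_polytime _ _ (fun e => if l e is x :: s then false else true)) => [e|].
  by case: (l e).
by apply: (polytime_case_seq (g := fun _ _ s => false)) => //; exact: polytime_const.
Qed.

Lemma polytime_neg (E : data) (f : E -> bool) : polytime f -> polytime (fun e => ~~ f e).
Proof.
move=> pf; apply: (@eq_polytime _ _ (fun e => if f e then false else true)) => [e|].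
  by case: (f e).
by apply: polytime_if => //; apply: polytime_const.
Qed.

Lemma polytime_and (E : data) (f g : E -> bool) :
  polytime f -> polytime g -> polytime (fun e => f e && g e).
Proof. by move=> pf pg; apply: (@polytime_if E bool_data f g (fun=> false)) => //; apply: polytime_const. Qed.

Lemma polytime_or (E : data) (f g : E -> bool) :
  polytime f -> polytime g -> polytime (fun e => f e || g e).
Proof. by move=> pf pg; apply: (@polytime_if E bool_data f (fun=> true) g) => //; apply: polytime_const. Qed.

Lemma polytime_xor (E : data) (f g : E -> bool) :
  polytime f -> polytime g -> polytime (fun e => f e (+) g e).
Proof.
move=> pf pg; apply: (@eq_polytime E bool_data (fun e => if f e then ~~ g e else g e)) => [e|].
  by case: (f e).
by apply: polytime_if => //; apply: polytime_neg.
Qed.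

Ltac polytime_step :=
  lazy beta;
  lazymatch goal with
  | |- polytime (fun _ => ?a) => apply: polytime_const
  | |- polytime (fun e => e) => apply: polytime_id
  | |- polytime fst => apply: polytime_proj1
  | |- polytime snd => apply: polytime_proj2
  | |- polytime (fun e => (_, _)) => apply: polytime_pair
  | |- polytime (fun e => (@?f e).1) => apply: (@polytime_fst _ _ _ f)
  | |- polytime (fun e => (@?f e).2) => apply: (@polytime_snd _ _ _ f)
  | |- polytime (fun e => _ && _) => apply: polytime_and
  | |- polytime (fun e => _ || _) => apply: polytime_or
  | |- polytime (fun e => _ (+) _) => apply: polytime_xor
  | |- polytime (fun e => ~~ _) => apply: polytime_neg
  | |- polytime (fun e => if (_ : bool) then _ else _) => apply: polytime_if
  | |- polytime (fun e => _ :: _) => apply: polytime_cons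
  | |- polytime (fun e => Some _) => apply: polytime_Some
  | |- polytime (fun e => head _ _) => apply: polytime_head
  | |- polytime (fun e => ohead _) => apply: polytime_ohead
  | |- polytime (fun e => behead _) => apply: polytime_behead
  | |- polytime (fun e => nilp _) => apply: polytime_nilp
  | |- _ => assumption
  end.

Ltac prove_polytime := repeat polytime_step.

Lemma polytime_rev (E A : data) (l : E -> seq A) :
  polytime l -> polytime (fun e => rev (l e)).
Proof.
move=> pl; apply: (@eq_polytime _ _ (fun e => foldl (fun s x => x :: s) [::] (l e))) => [e|].
  by rewrite -[l e in LHS]revK foldl_rev; elim: (rev _) => //= x s ->.
(* A new item adds its code and one marker bit. *)
apply: (@polytime_foldl _ _ _ (fun _ s x => x :: s) _ _ (fun n => n.+1)); prove_polytime.
  by apply: (@poly_bounded_le _ (fun n => n + 1)) => [n|]; [rewrite addn1 | prove_poly_bounded].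
move=> e s x n le; rewrite enc_cons -cat_cons size_cat addnC leq_add2l.
exact: leq_trans (leq_addl _ _) le.
Qed.

Lemma polytime_foldr (E A S : data) (f : E -> A -> S -> S) (l : E -> seq A)
    (a0 : E -> S) (g : nat -> nat) :
  polytime (fun p : E * S * A => f p.1.1 p.2 p.1.2) -> poly_bounded g ->
  (forall e a x n, size (enc e) + size (enc x) <= n ->
     size (enc (f e x a)) <= size (enc a) + g n) ->
  polytime l -> polytime a0 -> polytime (fun e => foldr (f e) (a0 e) (l e)).
Proof.
move=> pf pg hg pl pa.
apply: (@eq_polytime _ _ (fun e => foldl (fun a x => f e x a) (a0 e) (rev (l e)))) => [e|].
  exact: foldl_rev.
by apply: (polytime_foldl (f := fun e a x => f e x a) pf pg) => //; apply: polytime_rev.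
Qed.

Lemma polytime_cat (E A : data) (s t : E -> seq A) :
  polytime s -> polytime t -> polytime (fun e => s e ++ t e).
Proof.
move=> ps pt; apply: (@eq_polytime _ _ (fun e => foldr cons (t e) (s e))) => [e|].
  by elim: (s e) => //= x w ->.
apply: (@polytime_foldr _ _ _ (fun _ x s => x :: s) _ _ (fun n => n.+1)); prove_polytime.
  by apply: (@poly_bounded_le _ (fun n => n + 1)) => [n|]; [rewrite addn1 | prove_poly_bounded].
move=> e w x n le; rewrite enc_cons -cat_cons size_cat addnC leq_add2l.
exact: leq_trans (leq_addl _ _) le.
Qed.

Lemma size_enc_cat (A : data) (s t : seq A) :
  size (enc (s ++ t)) <= size (enc s) + size (enc t).
Proof.
elim: s => [|x s ih]; first exact: leq_addl.
by rewrite cat_cons !enc_cons -!cat_cons 2!size_cat -addnA leq_add2l.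
Qed.

Lemma polytime_flatten (E A : data) (l : E -> seq (seq A)) :
  polytime l -> polytime (fun e => flatten (l e)).
Proof.
move=> pl; apply: (@polytime_foldr _ _ _ (fun _ x s => x ++ s) _ _ (fun n => n)); prove_polytime.
- by apply: polytime_cat; prove_polytime.
- exact: poly_bounded_id.
move=> e w x n le; apply: leq_trans (size_enc_cat _ _) _; rewrite addnC leq_add2l.
by apply: leq_trans le; apply: leq_addl.
Qed.

Lemma polytime_map (E A B : data) (f : E -> A -> B) (l : E -> seq A) :
  polytime (fun p : E * A => f p.1 p.2) -> polytime l ->
  polytime (fun e => [seq f e x | x <- l e]).
Proof.
move=> pf pl; have [b pb hb] := polytime_size pf.
apply: (@eq_polytime _ _ (fun e => foldr (fun x s => f e x :: s) [::] (l e))) => [e|].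
  by elim: (l e) => //= x s ->.
apply: (@polytime_foldr _ _ _ (fun e x s => f e x :: s) _ _ (fun n => 1 + b n)); prove_polytime.
- by apply: (polytime_comp (f := fun p : E * seq B * A => (p.1.1, p.2)) pf); prove_polytime.
- by prove_poly_bounded.
move=> e w x n le; rewrite enc_cons -cat_cons size_cat addnC leq_add2l.
by rewrite add1n; apply: (hb (e, x)); rewrite enc_pair size_cat.
Qed.

Lemma polytime_filter (E A : data) (f : E -> A -> bool) (l : E -> seq A) :
  polytime (fun p : E * A => f p.1 p.2) -> polytime l ->
  polytime (fun e => [seq x <- l e | f e x]).
Proof.
move=> pf pl.
apply: (@polytime_foldr _ _ _ (fun e x s => if f e x then x :: s else s) _ _ (fun n => n.+1)); prove_polytime.
- by apply: (polytime_comp (f := fun p : E * seq A * A => (p.1.1, p.2)) pf); prove_polytime.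
- by apply: (@poly_bounded_le _ (fun n => n + 1)) => [n|]; [rewrite addn1 | prove_poly_bounded].
move=> e w x n le; case: (f e x); last by rewrite leq_addr.
rewrite enc_cons -cat_cons size_cat addnC leq_add2l.
exact: leq_trans (leq_addl _ _) le.
Qed.

Lemma polytime_all (E A : data) (f : E -> A -> bool) (l : E -> seq A) :
  polytime (fun p : E * A => f p.1 p.2) -> polytime l ->
  polytime (fun e => all (f e) (l e)).
Proof.
move=> pf pl.
apply: (@polytime_foldr _ _ _ (fun e x b => f e x && b) _ _ (fun n => 0)); prove_polytime.
- by apply: (polytime_comp (f := fun p : E * bool * A => (p.1.1, p.2)) pf); prove_polytime.
- exact: poly_bounded_const.
- by [].
Qed.

(** The unary code of [k e] is itself a list with one item per iteration, so this is a fold that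
    ignores the items. *)
Lemma polytime_iter (E S : data) (f : S -> S) (a0 : E -> S) (k : E -> unat) (c : nat) :
  polytime f -> (forall a, size (enc (f a)) <= size (enc a) + c) ->
  polytime k -> polytime a0 -> polytime (fun e => iter (k e) f (a0 e)).
Proof.
move=> pf hf pk pa.
apply: (@eq_polytime _ _ (fun e => foldl (fun a _ => f a) (a0 e) (unary (k e)))) => [e|].
  by elim: (k e : nat) (a0 e) => //= n ih a; rewrite ih -iterS iterSr.
apply: (@polytime_foldl _ _ _ (fun _ a _ => f a) _ _ (fun=> c)) => //.
- by apply: (polytime_comp pf); prove_polytime.
- exact: poly_bounded_const.
Qed.

Lemma polytime_nth (E A : data) (x0 : A) (s : E -> seq A) (i : E -> unat) :
  polytime s -> polytime i -> polytime (fun e => nth x0 (s e) (i e)).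
Proof.
move=> ps pi; apply: (@eq_polytime _ _ (fun e => head x0 (iter (i e) behead (s e)))) => [e|].
  by elim: (i e : nat) (s e) => [|n ih] [|x w] //=; rewrite -iterS iterSr ih ?nth_nil.
apply: polytime_head; apply: (@polytime_iter _ _ _ _ _ 0) => //.
  by apply: polytime_behead; prove_polytime.
by move=> w; rewrite addn0; apply: size_enc_behead.
Qed.

(** * Unary numbers as indices *)

Lemma enc_unat_succ (n : unat) : enc (n.+1 : unat) = [:: true, true & enc n].
Proof. by []. Qed.

Lemma size_enc_unat (n : unat) : size (enc n) = n.*2.+1.
Proof. by elim: n => // n ih; rewrite enc_unat_succ /= ih. Qed.

Lemma polytime_succ (E : data) (f : E -> unat) :
  polytime f -> polytime (fun e => (f e).+1 : unat).
Proof.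
move=> pf; apply: (@polytime_same_code _ (seq_data bool_data) _ (fun e => true :: unary (f e))) => //.
apply: polytime_cons; first exact: polytime_const.
exact: polytime_same_code pf.
Qed.

Lemma polytime_size_seq (E A : data) (s : E -> seq A) :
  polytime s -> polytime (fun e => size (s e) : unat).
Proof.
move=> ps; apply: (@eq_polytime _ _ (fun e => foldr (fun _ (n : unat) => n.+1 : unat) 0 (s e))) => [e|].
  by elim: (s e) => //= x w ->.
apply: (@polytime_foldr _ _ _ (fun _ _ (n : unat) => n.+1 : unat) _ _ (fun=> 2)); prove_polytime.
- by apply: polytime_succ; prove_polytime.
- exact: poly_bounded_const.
- by move=> e a x n _; rewrite enc_unat_succ addn2.
Qed.

Definition range (n : unat) : seq unat := iota 0 n.

Lemma size_enc_range_gen a n : size (enc (iota a n : seq unat)) <= n * (2 * (a + n)).+2 + 1.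
Proof.
elim: n a => // n ih a.
rewrite [iota _ _]/= enc_cons -cat_cons size_cat [size (_ :: _)]/= -/(enc _) size_enc_unat.
have := ih a.+1; rewrite addSnnS => h.
by rewrite mulSn -addnA -mul2n; apply: leq_add h; lia.
Qed.

(** The length of the list built so far is the next number to append. Its code grows with the
    accumulator, so additive growth fails for arbitrary accumulators; but those that occur are
    shorter ranges, of quadratic size. *)
Lemma polytime_range (E : data) (n : E -> unat) :
  polytime n -> polytime (fun e => range (n e)).
Proof.
move=> pn; pose f (s : seq unat) (b : bool) : seq unat := s ++ [:: size s : unat].
have fE k : foldl f [::] (nseq k true) = range k.
  have -> : foldl f [::] (nseq k true) = iter k (f^~ true) [::].
    by elim: k [::] => //= k ih s; rewrite ih -[f s true]/((f^~ true) s) -iterSr.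
  by elim: k => //= k ->; rewrite /f /range size_iota -[in RHS]addn1 iotaD.
have [b pb hb] := polytime_size pn.
have pu : polytime (fun e => unary (n e)) by apply: polytime_same_code pn.
apply: (@eq_polytime _ _ (fun e => foldl f [::] (unary (n e)))) => [e|]; first exact: fE.
apply: (@polytime_foldl_reachable _ _ _ (fun _ => f) _ _ (fun k => b k * (2 * b k + 2) + 1)); prove_polytime.
- by apply: polytime_cat; prove_polytime; apply: polytime_size_seq; prove_polytime.
- by prove_poly_bounded.
move=> e k i le; have -> : take i (unary (n e)) = unary (minn i (n e)).
  rewrite /minn; case: ltnP => [/ltnW|] h; first exact: take_nseq.
  by rewrite take_oversize // size_nseq.
rewrite [foldl _ _ _]fE; have := hb _ _ le; rewrite size_enc_unat => h.
apply: leq_trans (size_enc_range_gen 0 _) _; rewrite leq_add2r.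
by apply: leq_mul; lia.
Qed.

(** * Binary arithmetic *)

Definition bits_val (s : seq bool) : nat := foldr (fun (b : bool) n => b + n.*2) 0 s.

Lemma binary0 : binary 0 = [::].
Proof. by rewrite /binary up_log1. Qed.

Lemma binary_half n : 0 < n -> binary n = odd n :: binary n./2.
Proof.
move=> n0; rewrite /binary up_log2S // /mkseq /= divn1; congr (_ :: _).
rewrite -[1]addn0 iotaDl -map_comp; apply: eq_map => i /=.
by rewrite add1n expnS divnMA divn2.
Qed.

Lemma binaryK : cancel binary bits_val.
Proof.
elim/ltn_ind=> n ih; case: (posnP n) => [->|n0]; first by rewrite binary0.
by rewrite binary_half //= ih ?odd_double_half //; lia.
Qed.

(** Arithmetic on digit lists may produce leading zeros, which stand at the end here. Codes of
    numbers have none, so they must be removed before a digit list can be reread as a number. *)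
Definition trim (s : seq bool) : seq bool :=
  foldr (fun b w => if b || ~~ nilp w then b :: w else [::]) [::] s.

Lemma trimE s : trim s = binary (bits_val s).
Proof.
elim: s => [|b s /= ->]; first by rewrite binary0.
case: (posnP (bits_val s)) => [->|v0].
  by rewrite binary0; case: b => //=; rewrite binary_half //= binary0.
rewrite [in RHS]binary_half; last by rewrite -double_gt0 in v0; lia.
rewrite oddD odd_double addbF oddb halfD odd_double doubleK andbF add0n.
have -> : b./2 = 0 by case: b.
by rewrite [binary (bits_val s)]binary_half //= orbT.
Qed.

Lemma bits_val_cat s t : bits_val (s ++ t) = bits_val s + 2 ^ size s * bits_val t.
Proof. by elim: s => [|b s /= ->]; rewrite ?mul1n //= expnS; lia. Qed.

Lemma size_binaryD a b : size (binary (a + b)) <= size (binary a) + size (binary b) + 1.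
Proof.
rewrite /binary !size_mkseq; apply: up_log_min => //.
have := up_logP a.+1 (isT : 1 < 2); have := up_logP b.+1 (isT : 1 < 2).
by rewrite !expnD expn1; nia.
Qed.

(** The general bound for sums would double the size; growth by one bit is what keeps the
    accumulator of a multiplication small. *)
Lemma size_binary_double a : size (binary (a + a)) <= (size (binary a)).+1.
Proof.
rewrite /binary !size_mkseq; apply: up_log_min => //.
by have := up_logP a.+1 (isT : 1 < 2); rewrite expnS; lia.
Qed.

Lemma size_enc_bool (b : bool) : size (enc b) = 1.
Proof. by []. Qed.

Lemma size_enc_pair (A B : data) (a : A) (b : B) :
  size (enc (a, b)) = size (enc a) + size (enc b).
Proof. by rewrite enc_pair size_cat. Qed.

Lemma size_enc_cons (A : data) (x : A) (s : seq A) :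
  size (enc (x :: s)) = (size (enc x) + size (enc s)).+1.
Proof. by rewrite enc_cons -size_cat. Qed.

Lemma size_enc_bits (s : seq bool) : size (enc s) = (size s).*2.+1.
Proof. by elim: s => // b s ih; rewrite enc_cons /= ih. Qed.

Lemma size_enc_nat (n : nat) : size (enc n) = (size (binary n)).*2.+1.
Proof. exact: size_enc_bits. Qed.

Lemma polytime_binary (E : data) (f : E -> nat) :
  polytime f -> polytime (fun e => binary (f e)).
Proof. exact: polytime_same_code. Qed.

Lemma polytime_trim (E : data) (s : E -> seq bool) :
  polytime s -> polytime (fun e => trim (s e)).
Proof.
move=> ps.
apply: (@polytime_foldr _ _ _ (fun _ (b : bool) w => if b || ~~ nilp w then b :: w else [::])
  _ _ (fun=> 2)); prove_polytime.
  exact: poly_bounded_const.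
move=> e w b n _; case: ifP => _; rewrite ?enc_cons /=; lia.
Qed.

Lemma polytime_bits_val (E : data) (s : E -> seq bool) :
  polytime s -> polytime (fun e => bits_val (s e)).
Proof.
move=> ps; apply: (@polytime_same_code _ (seq_data bool_data) _ (fun e => trim (s e))) => [e|].
  by rewrite trimE.
exact: polytime_trim.
Qed.

(* Carry, remaining summands and the bits of the sum, the most significant first. *)
Definition add_step (st : bool * (seq bool * seq bool) * seq bool) :=
  ((head false st.1.2.1 && head false st.1.2.2)
     || (st.1.1 && (head false st.1.2.1 || head false st.1.2.2)),
   (behead st.1.2.1, behead st.1.2.2),
   (head false st.1.2.1 (+) head false st.1.2.2 (+) st.1.1) :: st.2).

Lemma bits_val_behead s : bits_val s = head false s + (bits_val (behead s)).*2.
Proof. by case: s. Qed.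

(** A step moves one digit from the unread part to the output, and the total value is conserved:
    digits emitted, plus the weight of the next position times the carry and the unread summands. *)
Lemma add_step_val k c s t w :
  let st := iter k add_step (c, (s, t), w) in
  [/\ bits_val (rev st.2) + 2 ^ size st.2 * (st.1.1 + bits_val st.1.2.1 + bits_val st.1.2.2)
      = bits_val (rev w) + 2 ^ size w * (c + bits_val s + bits_val t),
      st.1.2.1 = drop k s & st.1.2.2 = drop k t].
Proof.
elim: k => [|k ih]; first by rewrite !drop0.
rewrite iterS; case: (iter k _ _) ih => [[c' [s' t']] w'] /= [<- -> ->].
rewrite -!drop1 !drop_drop add1n; split=> //.
rewrite rev_cons -cats1 bits_val_cat size_rev expnS.
rewrite [bits_val (drop k s)]bits_val_behead [bits_val (drop k t)]bits_val_behead.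
rewrite -!drop1 !drop_drop add1n.
move: (bits_val (drop _ s)) (bits_val (drop _ t)) (2 ^ _) (bits_val (rev _)) => a b p v.
by case: (head false (drop k s)); case: (head false (drop k t)); case: c' => /=; lia.
Qed.

(** After [size s + size t] steps both summands are used up; one more step emits the carry. *)
Definition add_bits (s t : seq bool) : seq bool :=
  rev (iter (size s + size t).+1 add_step (false, (s, t), [::])).2.

Lemma add_bitsP s t : bits_val (add_bits s t) = bits_val s + bits_val t.
Proof.
rewrite /add_bits iterS.
have [] := add_step_val (size s + size t) false s t [::].
have [] := add_step_val (size s + size t).+1 false s t [::].
rewrite iterS; case: (iter _ _ _) => [[c [s' t']] w] /= e _ _ _ es et; move: e.
rewrite es et !drop_oversize; try by lia.
by rewrite /= andbF addn0 muln0 addn0 add0n mul1n.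
Qed.

Lemma polytime_addn (E : data) (f g : E -> nat) :
  polytime f -> polytime g -> polytime (fun e => f e + g e).
Proof.
move=> pf pg; have pf' := polytime_binary pf; have pg' := polytime_binary pg.
apply: (@eq_polytime _ _ (fun e => bits_val (add_bits (binary (f e)) (binary (g e))))) => [e|].
  by rewrite add_bitsP !binaryK.
apply: polytime_bits_val; apply: polytime_rev; apply: polytime_snd.
apply: (@eq_polytime _ _ (fun e => iter (size (true :: binary (f e) ++ binary (g e))) add_step
   (false, (binary (f e), binary (g e)), [::]))) => [e|]; first by rewrite /= size_cat.
apply: (@polytime_iter _ _ _ _ _ 2); last by prove_polytime.
- by rewrite /add_step; prove_polytime.
- move=> [[c [s t]] w]; rewrite /add_step; cbn [fst snd].
  rewrite !size_enc_pair size_enc_cons !size_enc_bool.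
  have hs : size (enc (@behead bool s)) <= size (enc s) := size_enc_behead s.
  have ht : size (enc (@behead bool t)) <= size (enc t) := size_enc_behead t.
  by lia.
- by apply: polytime_size_seq; apply: polytime_cons; prove_polytime; apply: polytime_cat.
Qed.

Definition leq_step (st : seq bool * seq bool * bool) :=
  (behead st.1.1, behead st.1.2,
   if head false st.1.1 (+) head false st.1.2 then head false st.1.2 else st.2).

(** Digits come least significant first, so each differing pair overrides the verdict so far. Adding
    the verdict as 0 or 1 to the right side gives an invariant strict comparison; the initial value
    [true] makes it [<=]. *)
Lemma leq_step_val k s t r :
  let st := iter k leq_step (s, t, r) in
  [/\ bits_val st.1.1 < bits_val st.1.2 + st.2 = (bits_val s < bits_val t + r),
      st.1.1 = drop k s & st.1.2 = drop k t].
Proof.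
elim: k => [|k ih]; first by rewrite !drop0.
rewrite iterS; case: (iter k _ _) ih => [[s' t'] r'] /= [<- -> ->].
rewrite -!drop1 !drop_drop add1n; split=> //.
rewrite [bits_val (drop k s)]bits_val_behead [bits_val (drop k t)]bits_val_behead.
rewrite -!drop1 !drop_drop add1n.
move: (bits_val (drop _ s)) (bits_val (drop _ t)) => a b.
by case: (head false (drop k s)); case: (head false (drop k t)); case: r' => /=; lia.
Qed.

Lemma polytime_leq (E : data) (f g : E -> nat) :
  polytime f -> polytime g -> polytime (fun e => f e <= g e).
Proof.
move=> pf pg; have pf' := polytime_binary pf; have pg' := polytime_binary pg.
apply: (@eq_polytime _ _ (fun e => (iter (size (binary (f e) ++ binary (g e))) leq_step
   (binary (f e), binary (g e), true)).2)) => [e|].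
  set k := size _.
  have [] := leq_step_val k (binary (f e)) (binary (g e)) true.
  case: (iter _ _ _) => [[s' t'] r] /= h es et; move: h.
  rewrite es et !drop_oversize /k ?size_cat ?leq_addl ?leq_addr //.
  by rewrite /= !binaryK add0n addn1 ltnS => <-; case: r.
apply: polytime_snd; apply: (@polytime_iter _ _ _ _ _ 0); last by prove_polytime.
- by rewrite /leq_step; prove_polytime.
- move=> [[s t] r]; rewrite /leq_step; cbn [fst snd].
  rewrite !size_enc_pair !size_enc_bool.
  have hs : size (enc (@behead bool s)) <= size (enc s) := size_enc_behead s.
  have ht : size (enc (@behead bool t)) <= size (enc t) := size_enc_behead t.
  by lia.
- by apply: polytime_size_seq; apply: polytime_cat.
Qed.

Lemma polytime_eqn (E : data) (f g : E -> nat) :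
  polytime f -> polytime g -> polytime (fun e => f e == g e).
Proof.
move=> pf pg; apply: (@eq_polytime _ _ (fun e => (f e <= g e) && (g e <= f e))) => [e|].
  by rewrite eqn_leq.
by apply: polytime_and; apply: polytime_leq.
Qed.

(** Horner's scheme on the digits of [f e]: a round doubles the accumulator, which costs one bit,
    and adds at most [g e], so the growth is additive. *)
Lemma polytime_muln (E : data) (f g : E -> nat) :
  polytime f -> polytime g -> polytime (fun e => f e * g e).
Proof.
move=> pf pg.
apply: (@eq_polytime _ _ (fun e => foldr
   (fun (b : bool) (a : nat) => a + a + if b then g e else 0) 0 (binary (f e)))) => [e|].
  rewrite -[in RHS](binaryK (f e)).
  by elim: (binary (f e)) => //= b s ->; case: b; lia.
have [m pm hm] := polytime_size pg.
apply: (@polytime_foldr _ _ _ (fun e (b : bool) (a : nat) => a + a + if b then g e else 0)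
  _ _ (fun n => 2 * m n + 10)); prove_polytime.
- apply: polytime_addn; first by apply: polytime_addn; prove_polytime.
  by prove_polytime; apply: (polytime_comp pg); prove_polytime.
- by prove_poly_bounded.
- move=> e a b n le; have := hm e n (leq_trans (leq_addr _ _) le).
  rewrite !size_enc_nat; have := size_binaryD (a + a) (if b then g e else 0).
  have := size_binary_double a; case: b {le}; rewrite ?binary0 /=; lia.
Qed.

Lemma polytime_sumn (E : data) (s : E -> seq nat) :
  polytime s -> polytime (fun e => sumn (s e)).
Proof.
move=> ps; apply: (@polytime_foldr _ _ _ (fun _ (a b : nat) => a + b) _ _ (fun n => n + 2)); prove_polytime.
- by apply: polytime_addn; prove_polytime.
- by prove_poly_bounded.
- move=> e b a n le; have := size_binaryD a b.
  by move: le; rewrite !size_enc_nat; lia.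
Qed.

Lemma polytime_nat_of_unat (E : data) (f : E -> unat) :
  polytime f -> polytime (fun e => f e : nat).
Proof.
move=> pf; have pu : polytime (fun e => unary (f e)) by exact: polytime_same_code pf.
apply: (@eq_polytime _ _ (fun e => sumn [seq 1 | _ <- unary (f e)])) => [e|].
  by rewrite /unary map_nseq sumn_nseq mul1n.
by apply: polytime_sumn; apply: (@polytime_map _ _ _ (fun _ _ => 1)); prove_polytime.
Qed.

(** * The brute-force search *)

(** A name of its own lets the automation distinguish comparison of unary indices, which converts
    them first, from that of binary numbers. *)
Definition same_index (x y : unat) : bool := x == y :> nat.

Lemma polytime_same_index (E : data) (f g : E -> unat) :
  polytime f -> polytime g -> polytime (fun e => same_index (f e) (g e)).
Proof. by move=> pf pg; apply: polytime_eqn; apply: polytime_nat_of_unat. Qed.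

Ltac polytime_step ::=
  lazy beta;
  lazymatch goal with
  | |- polytime (fun _ => ?a) => apply: polytime_const
  | |- polytime (fun e => e) => apply: polytime_id
  | |- polytime fst => apply: polytime_proj1
  | |- polytime snd => apply: polytime_proj2
  | |- polytime (fun e => (_, _)) => apply: polytime_pair
  | |- polytime (fun e => (@?f e).1) => apply: (@polytime_fst _ _ _ f)
  | |- polytime (fun e => (@?f e).2) => apply: (@polytime_snd _ _ _ f)
  | |- polytime (fun e => _ && _) => apply: polytime_and
  | |- polytime (fun e => ~~ _) => apply: polytime_neg
  | |- polytime (fun e => if (_ : bool) then _ else _) => apply: polytime_if
  | |- polytime (fun e => _ :: _) => apply: polytime_cons
  | |- polytime (fun e => _ ++ _) => apply: polytime_cat
  | |- polytime (fun e => flatten _) => apply: polytime_flatten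
  | |- polytime (fun e => Some _) => apply: polytime_Some
  | |- polytime (fun e => ohead _) => apply: polytime_ohead
  | |- polytime (fun e => nth _ _ _) => apply: polytime_nth
  | |- polytime (fun e => range _) => apply: polytime_range
  | |- polytime (fun e => sumn _) => apply: polytime_sumn
  | |- polytime (fun e => [seq @?f e x | x <- @?l e]) => apply: (@polytime_map _ _ _ f l)
  | |- polytime (fun e => [seq x <- @?l e | @?f e x]) => apply: (@polytime_filter _ _ f l)
  | |- polytime (fun e => all (@?f e) (@?l e)) => apply: (@polytime_all _ _ f l)
  | |- polytime (fun e => _ + _) => apply: polytime_addn
  | |- polytime (fun e => _ * _) => apply: polytime_muln
  | |- polytime (fun e => _ <= _) => apply: polytime_leq
  | |- polytime (fun e => size _) => apply: polytime_size_seq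
  | |- polytime (fun e => _ == _) => apply: polytime_eqn
  | |- polytime (fun e => same_index _ _) => apply: polytime_same_index
  | |- _ => first [assumption | apply: polytime_case_option]
  end.

(* The order of the fields is that of [encode_instance]; rationals are pairs of
   a numerator and a denominator. *)
Definition input : Type :=
  seq (nat * seq nat) * (seq (seq nat * seq (nat * nat)) * (nat * nat)).

Notation nats := (seq_data nat_data).
Notation input_data :=
  (prod_data (seq_data (prod_data nat_data nats))
     (prod_data (seq_data (prod_data nats (seq_data (prod_data nat_data nat_data))))
        (prod_data nat_data nat_data))).

Notation assignment := (seq (option unat)).

Section Search.
Implicit Types (D : input) (t x ti tj : unat) (s : assignment).

Definition course_list D : seq unat := range (size D.1).
Definition ta_list D : seq unat := range (size D.2.1).
Definition course_row D x : nat * seq nat := nth (0, [::]) D.1 x.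
Definition ta_row D t : seq nat * seq (nat * nat) := nth ([::], [::]) D.2.1 t.
Definition input_utility D t x : nat := nth 0 (ta_row D t).1 x.
Definition input_grade D t x : nat * nat := nth (0, 0) (ta_row D t).2 x.

Definition ratio_le (p q : nat * nat) : bool := p.1 * q.2 <= q.1 * p.2.

Definition assigned_to s t x : bool :=
  if nth None s t is Some y then same_index y x else false.

Definition course_ok D s x : bool :=
  (sumn [seq if assigned_to s t x then 1 else 0 | t <- ta_list D] == (course_row D x).1) &&
  (D.2.2.1 * (course_row D x).1 <=
   D.2.2.2 * sumn [seq if assigned_to s t x then nth 0 (course_row D x).2 t else 0
                  | t <- ta_list D]).

Definition ta_ok D s t : bool :=
  if nth None s t is Some x then 1 <= input_utility D t x else true.

Definition no_envy D s ti tj : bool :=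
  if nth None s tj is Some x then
    ~~ (ratio_le (input_grade D tj x) (input_grade D ti x) &&
        ((if nth None s ti is Some y then input_utility D ti y else 0) + 1
          <= input_utility D ti x))
  else true.

Definition check D s : bool :=
  all (course_ok D s) (course_list D) &&
  (all (ta_ok D s) (ta_list D) &&
   all (fun ti => all (no_envy D s ti) (ta_list D)) (ta_list D)).

Definition update s t x : assignment :=
  [seq if same_index t' t then Some x else nth None s t' | t' <- range (size s)].

Definition updates D s : seq assignment :=
  flatten [seq [seq update s t x | x <- course_list D] | t <- ta_list D].

(** A round multiplies the length of the list by one plus the number of pairs of a TA and a course.
    Keeping the previous list retains matchings with fewer assigned TAs. *)
Fixpoint candidates k D : seq assignment :=
  if k is k'.+1 then candidates k' D ++ flatten [seq updates D s | s <- candidates k' D]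
  else [:: [seq None | _ <- D.2.1]].

(** The final map changes no value, only the code: course indices pass from unary to the binary form
    required of the output. *)
Definition search k D : option (seq (option nat)) :=
  if ohead [seq s <- candidates k D | check D s] is Some s then
    Some [seq (if o is Some x then Some (x : nat) else None) | o : option unat <- s]
  else None.

End Search.

Notation unat_seq := (seq_data (option_data unat_data)).

Lemma polytime_check :
  polytime (A := prod_data input_data unat_seq) (fun p => check p.1 p.2).
Proof.
rewrite /check /course_ok /ta_ok /no_envy /assigned_to /input_utility /input_grade
  /course_row /ta_row /course_list /ta_list /ratio_le.
by prove_polytime.
Qed.

(** The induction builds a different program for each [k], with its own bound; no polynomial uniform
    in [k] is claimed. *)
Lemma polytime_candidates k : polytime (A := input_data) (candidates k).
Proof.
elim: k => [|k ih] /=; first by rewrite /candidates; prove_polytime.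
rewrite /updates /update /course_list /ta_list; prove_polytime.
Qed.

Lemma polytime_search k : polytime (A := input_data) (search k).
Proof.
have pc := polytime_candidates k; have pk := polytime_check.
rewrite /search; prove_polytime.
- exact: polytime_nat_of_unat (polytime_proj2 _ _).
Qed.

(** * Correctness of the search *)

Definition rat_code (q : rat) : nat * nat := (`|numq q|%N, `|denq q|%N).

Definition input_of (I : instance) : input :=
  ([seq (capacity x, codom (valuation x)) | x <- enum 'I_(ncourses I)],
   ([seq (codom (utility t), [seq rat_code q | q <- codom (grade t)]) | t <- enum 'I_(ntas I)],
    rat_code (threshold I))).

Definition matching_code (I : instance) (mu : matching I) : seq (option nat) :=
  [seq omap (@nat_of_ord _) o | o <- codom mu].

Lemma encode_seq_map (A B : Type) (f : A -> B) (e : B -> seq bool) (e' : A -> seq bool) s :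
  (forall a, e (f a) = e' a) -> encode_seq e (map f s) = encode_seq e' s.
Proof.
by move=> ee; rewrite /encode_seq -map_comp; congr (flatten _ ++ _); apply: eq_map => a /=; rewrite ee.
Qed.

(** Agreement bit by bit means that the program runs directly on the given input, without
    preprocessing. *)
Lemma enc_input (I : instance) : @enc input_data (input_of I) = encode_instance I.
Proof.
rewrite /encode_instance !enc_pair; congr (_ ++ (_ ++ _)).
  by apply: encode_seq_map.
apply: encode_seq_map => t; rewrite enc_pair; congr (_ ++ _).
by apply: encode_seq_map.
Qed.

Lemma enc_answer (I : instance) (ans : option (matching I)) :
  enc (omap (@matching_code I) ans) = encode_answer ans.
Proof.
case: ans => [mu|] //=; congr (_ :: _); apply: encode_seq_map; by case.
Qed.

Section Correctness.
Variable I : instance.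
Notation n := (ncourses I).
Notation m := (ntas I).
Implicit Types (mu : matching I) (x : 'I_n) (t : 'I_m).

Lemma nth_map_enum (T : Type) (k : nat) (f : 'I_k -> T) (d : T) (i : 'I_k) :
  nth d [seq f j | j <- enum 'I_k] i = f i.
Proof. by rewrite (nth_map i) ?size_enum_ord // nth_ord_enum. Qed.

Lemma nth_codom (T : Type) (k : nat) (f : 'I_k -> T) (d : T) (i : 'I_k) :
  nth d (codom f) i = f i.
Proof. exact: nth_map_enum. Qed.

Lemma course_rowE x : course_row (input_of I) x = (capacity x, codom (valuation x)).
Proof. exact: nth_map_enum. Qed.

Lemma input_utilityE t x : input_utility (input_of I) t x = utility t x.
Proof. by rewrite /input_utility /ta_row nth_map_enum nth_codom. Qed.

Lemma input_gradeE t x : input_grade (input_of I) t x = rat_code (grade t x).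
Proof.
by rewrite /input_grade /ta_row nth_map_enum /= -map_comp nth_map_enum.
Qed.

Lemma nth_matching_code mu t :
  nth None (matching_code mu) t = omap (@nat_of_ord _) (mu t).
Proof. by rewrite /matching_code -map_comp nth_map_enum. Qed.

Lemma assigned_toE mu t x : assigned_to (matching_code mu) t x = (t \in assigned mu x).
Proof. by rewrite /assigned_to nth_matching_code inE; case: (mu t). Qed.

Lemma range_enum k : range k = [seq val i | i <- enum 'I_k].
Proof. by rewrite val_enum_ord. Qed.

Lemma course_listE : course_list (input_of I) = [seq val x | x <- enum 'I_n].
Proof. by rewrite -range_enum /course_list /= size_map size_enum_ord. Qed.

Lemma ta_listE : ta_list (input_of I) = [seq val t | t <- enum 'I_m].
Proof. by rewrite -range_enum /ta_list /= size_map size_enum_ord. Qed.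

Lemma all_range (k : nat) (p : pred nat) :
  reflect (forall i : 'I_k, p i) (all p [seq val i | i <- enum 'I_k]).
Proof.
rewrite all_map; apply: (iffP allP) => h i; last by move=> _; apply: h.
by apply: h; rewrite mem_enum.
Qed.

Lemma sumn_enum k (f : nat -> nat) :
  sumn [seq f i | i <- [seq val i | i <- enum 'I_k]] = \sum_(i < k) f i.
Proof. by rewrite -range_enum sumnE big_map -(big_mkord xpredT) /index_iota subn0. Qed.

Lemma rat_code_div (q : rat) : (0 <= q)%R ->
  q = (`|numq q|%:R / `|denq q|%:R)%R.
Proof.
move=> q0; rewrite -[LHS]divq_num_den.
by rewrite -[in LHS](gez0_abs (_ : 0 <= numq q)%R) ?numq_ge0 // -[in LHS]absz_denq.
Qed.

Lemma absz_denq_gt0 (q : rat) : (0 < `|denq q|%:R :> rat)%R.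
Proof. by rewrite ltr0n absz_gt0 denq_eq0. Qed.

Lemma rat_codeE (p q : rat) : (0 <= p)%R -> (0 <= q)%R ->
  ratio_le (rat_code p) (rat_code q) = (p <= q)%R.
Proof.
move=> p0 q0; rewrite [in RHS](rat_code_div p0) [in RHS](rat_code_div q0).
rewrite ler_pdivrMr ?absz_denq_gt0 // mulrAC ler_pdivlMr ?absz_denq_gt0 //.
by rewrite -!natrM ler_nat.
Qed.

(** Clearing the positive denominators, that of the threshold and the capacity, reduces the
    comparison to natural numbers. *)
Lemma threshold_code mu x :
  (`|numq (threshold I)| * capacity x <=
   `|denq (threshold I)| * \sum_(t in assigned mu x) valuation x t) =
  (threshold I <= avg_util mu x)%R.
Proof.
have c0 : (0 < (capacity x)%:R :> rat)%R by rewrite ltr0n capacity_gt0.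
rewrite [in RHS](rat_code_div (threshold_ge0 I)) /avg_util -natr_sum.
rewrite ler_pdivrMr ?absz_denq_gt0 // -mulrA ler_pdivlMl // mulrC.
by rewrite -!natrM ler_nat [X in _ <= X]mulnC.
Qed.

Lemma checkP mu : check (input_of I) (matching_code mu) <-> mefe mu.
Proof.
rewrite /check course_listE ta_listE; split.
  case/and3P => /all_range h1 /all_range h2 /all_range h3.
  split; first split.
  - move=> x; have /andP[/eqP + _] := h1 x.
    rewrite ta_listE sumn_enum course_rowE /= => <-.
    by rewrite -sum1_card [LHS]big_mkcond; apply: eq_bigr => t _; rewrite assigned_toE.
  - move=> t x e; have := h2 t; rewrite /ta_ok nth_matching_code e /= input_utilityE; lia.
  - move=> x; have /andP[_ +] := h1 x.
    rewrite ta_listE sumn_enum course_rowE /= -threshold_code => h.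
    apply: leq_trans h _; rewrite leq_mul2l; apply/orP; right.
    rewrite [X in _ <= X]big_mkcond; apply: leq_sum => t _.
    by rewrite /= assigned_toE nth_codom.
  - move=> [ti [tj [x [e le lt]]]]; have /all_range/(_ tj) := h3 ti.
    rewrite /no_envy !nth_matching_code e /= !input_gradeE rat_codeE ?grade_ge0 // le /=.
    rewrite input_utilityE; case: (mu ti) lt => [y|] /=; rewrite ?input_utilityE /=; lia.
move=> [[h1 h2] h3 h4]; apply/and3P; split; apply/all_range.
- move=> x; rewrite /course_ok ta_listE !sumn_enum course_rowE /=; apply/andP; split.
    rewrite -h1 -sum1_card [X in _ == X]big_mkcond /=; apply/eqP; apply: eq_bigr => t _.
    by rewrite assigned_toE.
  have := h3 x; rewrite -threshold_code; apply: (fun a b => leq_trans b a).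
  rewrite leq_mul2l; apply/orP; right.
  rewrite [X in X <= _]big_mkcond; apply: leq_sum => t _.
  by rewrite assigned_toE nth_codom.
- move=> t; rewrite /ta_ok nth_matching_code; case e: (mu t) => [x|] //=.
  by rewrite input_utilityE lt0n; apply/eqP; apply: h2.
- move=> ti; apply/all_range => tj; rewrite /no_envy !nth_matching_code.
  case e: (mu tj) => [x|] //=; apply/negP => /andP[].
  rewrite !input_gradeE rat_codeE ?grade_ge0 // => le lt; apply: h4; exists ti, tj, x; split=> //.
  by move: lt; rewrite input_utilityE; case: (mu ti) => [y|] /=; rewrite ?input_utilityE /=; lia.
Qed.

(** * Matchings reached by successive reassignments *)

Lemma update_code mu t x :
  update (matching_code mu) t x =
  matching_code [ffun t' => if t' == t then Some x else mu t'].
Proof.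
rewrite /update; have -> : size (matching_code mu) = m by rewrite size_map size_codom card_ord.
rewrite range_enum [RHS]/matching_code -!map_comp; apply: eq_map => t' /=.
by rewrite ffunE nth_matching_code /same_index -val_eqE; case: ifP.
Qed.

Lemma empty_code : [seq None | _ <- (input_of I).2.1] = matching_code ([ffun=> None] : matching I).
Proof. by rewrite /matching_code /= -!map_comp; apply: eq_map => t /=; rewrite ffunE. Qed.

Lemma updatesP mu (s : seq (option nat)) :
  reflect (exists t x, s = update (matching_code mu) t x)
    (s \in updates (input_of I) (matching_code mu)).
Proof.
rewrite /updates course_listE ta_listE; apply: (iffP flattenP).
  by move=> [_ /mapP[_ /mapP[t _ ->] ->] /mapP[_ /mapP[x _ ->] ->]]; exists t, x.
move=> [t [x ->]]; exists [seq update (matching_code mu) t (y : nat) | y <- [seq val x | x <- enum 'I_n]].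
  by apply/mapP; exists (t : nat) => //; rewrite map_f ?mem_enum.
by apply/mapP; exists (x : nat) => //; rewrite map_f ?mem_enum.
Qed.

(** This is the soundness half: [checkP] speaks of codes of matchings only, so a list found by the
    search must be known to be one. *)
Lemma candidates_code k (s : seq (option nat)) :
  s \in candidates k (input_of I) -> exists mu, s = matching_code mu.
Proof.
elim: k s => [|k ih] s; first by rewrite inE empty_code => /eqP ->; eexists.
rewrite mem_cat => /orP[/ih //|/flattenP[_ /mapP[s' /ih[mu ->] ->] /updatesP[t [x ->]]]].
by rewrite update_code; eexists.
Qed.

(** Unassigning one assigned TA gives a matching available one round earlier, and reassigning that
    TA recovers [mu]. The empty matching is kept from the start. *)
Lemma mem_candidates k mu :
  #|[set t | mu t != None]| <= k -> matching_code mu \in candidates k (input_of I).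
Proof.
elim: k mu => [|k ih] mu.
  rewrite leqn0 cards_eq0 => /eqP e; rewrite inE empty_code; apply/eqP.
  congr matching_code; apply/ffunP => t; rewrite ffunE.
  by have := in_set0 t; rewrite -e inE => /negbFE/eqP.
rewrite /= mem_cat; case: (set_0Vmem [set t | mu t != None]) => [e _|[t tP] le].
  by rewrite ih // e cards0.
case e: (mu t) => [x|]; last by rewrite inE e in tP.
pose mu' : matching I := [ffun t' => if t' == t then None else mu t'].
apply/orP; right; apply/flattenP; exists (updates (input_of I) (matching_code mu')).
  apply/map_f/ih; rewrite -ltnS; apply: leq_trans le.
  rewrite (cardsD1 t [set t | mu t != None]) tP add1n ltnS subset_leq_card //; apply/subsetP => t'.
  by rewrite !inE ffunE; case: ifP.
apply/updatesP; exists t, x; rewrite update_code; congr matching_code.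
by apply/ffunP => t'; rewrite !ffunE; case: eqP => // ->.
Qed.

(** Double counting of the pairs of a TA and its course: feasibility makes each capacity the number
    of TAs assigned there, and exchanging the sums counts every assigned TA. *)
Lemma card_assigned mu : feasible mu ->
  #|[set t | mu t != None]| <= \sum_(x < n) capacity x.
Proof.
move=> [h _]; rewrite -(eq_bigr _ (fun x _ => h x)).
under eq_bigr do rewrite -sum1_card big_mkcond.
rewrite -sum1_card big_mkcond exchange_big /=; apply: leq_sum => t _.
rewrite inE; case e: (mu t) => [x|] //=.
by rewrite (bigD1 x) //= inE e eqxx.
Qed.

Lemma search_correct k : \sum_(x < n) capacity x <= k ->
  exists2 ans : option (matching I),
    search k (input_of I) = omap (@matching_code I) ans & correct_answer ans.
Proof.
move=> le; rewrite /search.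
case e: [seq s <- _ | _] => [|s w] /=.
  exists None => //= -[mu ok]; have [f _ _] := ok.
  have := mem_candidates (leq_trans (card_assigned f) le).
  move=> hm; suff: matching_code mu \in [::] by [].
  by rewrite -e mem_filter hm andbT; apply/checkP.
have : s \in [seq s <- candidates k (input_of I) | check (input_of I) s].
  by rewrite e mem_head.
rewrite mem_filter => /andP[ok /candidates_code[mu es]]; subst s.
exists (Some mu) => /=; last exact/checkP.
(* Recoding the indices from unary to binary is the identity on values. *)
by congr Some; rewrite -[RHS]map_id; apply: eq_map; case.
Qed.

End Correctness.

Theorem theorem7 (N C : nat) :
  exists (M : machine) (p : {poly nat}),
    forall I : instance,
      (ncourses I <= N)%N ->
      (forall x : 'I_(ncourses I), (capacity x <= C)%N) ->
      exists2 ans : option (matching I),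
        outputs_within M (horner p (size (encode_instance I)))
          (encode_instance I) (encode_answer ans)
        & correct_answer ans.
Proof.
(* The program depends on [N * C] alone, which bounds the total capacity of every admissible
   instance, so one machine serves them all. *)
have [c [b [[d hb] h]]] := polytime_search (N * C).
exists (compile c), (('X + 2%N%:P) ^+ d)%R => I leN leC.
have le : \sum_(x < ncourses I) capacity x <= N * C.
  apply: (@leq_trans (\sum_(x < ncourses I) C)); first by apply: leq_sum => x _; apply: leC.
  by rewrite sum_nat_const card_ord leq_mul2r leN orbT.
have [ans e ok] := search_correct le; exists ans => //.
have := h (input_of I) _ [::] [::] [::] (leqnn _).
rewrite e enc_input enc_answer !cats0 => run.
apply: exec_outputs (exec_weaken run _).
by rewrite horner_exp hornerD hornerX hornerC; apply: hb.
Qed.
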